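(* Let $\chi\in\{\pm1\}^{\binom{[n]}{k}}$ be a realizable uniform chirotope and let $R^\chi_{k,n}$ be the set of primitive integer generators of rays of the chirotropical Dressian $\mathrm{Dr}^\chi(k,n)$. For any subcollection $\{\pi_1,\dots,\pi_d\}\subseteq R^\chi_{k,n}$ which is maximal by inclusion among subcollections of pairwise $\chi$-compatible elements (i.e. $\pi_i+\pi_j\in\mathrm{Dr}^\chi(k,n)$ for all $i,j\in[d]$), the cone $\{t_1\pi_1+\dots+t_d\pi_d: t_1,\dots,t_d\ge0\}$ is a maximal cone of $\mathrm{Dr}^\chi(k,n)$. Moreover, every maximal cone of $\mathrm{Dr}^\chi(k,n)$ is uniquely characterized by such a collection.
   Context: A uniform realizable chirotope is $\chi\in\{\pm1\}^{\binom{[n]}{k}}$ with $\chi_I=\operatorname{sign}p_I(g)$ (indices sorted) for some real $k\times n$ matrix $g$ with all maximal minors nonzero. For a real polynomial $f$ in the Plücker variables, $f^\chi_\pm$ is the sum of the terms of $f$ whose evaluation at $p=\chi$ has sign $\pm1$; $\mathrm{Trop}(h)(x)=\min\alpha\cdot x$ over exponent vectors $\alpha$ of monomials of $h$; and $\mathrm{Trop}^\chi V(f)=\{x\in\mathbb{R}^{\binom nk}:\mathrm{Trop}(f^\chi_+)(x)=\mathrm{Trop}(f^\chi_-)(x)\}$. The chirotropical Dressian is $\mathrm{Dr}^\chi(k,n)=\bigcap_{f\in P_{k,n}}\mathrm{Trop}^\chi V(f)$, where $P_{k,n}$ is the set of three-term Plücker relations of $\mathrm{G}(k,n)$ (for $L\in\binom{[n]}{k-2}$,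 $\{a,b,c,d\}\in\binom{[n]}4$ disjoint from $L$, the Grassmann–Plücker relation among $p_{Lab}p_{Lcd},p_{Lac}p_{Lbd},p_{Lad}p_{Lbc}$). Rays are taken modulo the lineality space, the image of $x\mapsto(\sum_{i\in I}x_i)_I$, $x\in\mathbb{R}^n$. *)

(* Defs.v *)
From HB Require Import structures.
From mathcomp Require Import all_boot all_order all_algebra finmap.
(* mpoly has to come before constructive_ereal: in the other order their
   notations clash. *)
From mathcomp Require Import mpoly.
From mathcomp Require Import boolp classical_sets reals constructive_ereal.

Set Implicit Arguments.
Unset Strict Implicit.
Unset Printing Implicit Defensive.

Import Order.TTheory GRing.Theory Num.Theory.
Import Quotient.Exports.

Local Open Scope ring_scope.
Local Open Scope quotient_scope.

Definition ksub (k n : nat) : Type := {I : {set 'I_n} | #|I| == k}.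
HB.instance Definition _ (k n : nat) := Finite.on (ksub k n).
HB.instance Definition _ (k n : nat) := SubType.on (ksub k n).

(* Plücker coordinates are numbered by 'I_(npl k n), through enum_val and
   enum_rank on ksub k n. *)
Definition npl (k n : nat) : nat := #|{: ksub k n}|.

(* enum_val lists the elements of I increasingly. *)
Definition minor (R : realType) (k n : nat) (g : 'M[R]_(k, n)) (I : ksub k n) :
    R :=
  \det (colsub (fun j : 'I_k =>
          enum_val (cast_ord (esym (eqP (valP I))) j : 'I_#|val I|)) g).

Definition realizable_uniform_chirotope (R : realType) (k n : nat)
    (chi : ksub k n -> R) : Prop :=
  exists g : 'M[R]_(k, n),
    forall I, minor g I != 0 /\ chi I = Num.sg (minor g I).

(* The variable p_I; 0 is a junk value for sets I with #|I| <> k. *)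
Definition pvar (R : realType) (k n : nat) (I : {set 'I_n}) :
    {mpoly R[npl k n]} :=
  if insub I is Some J then 'X_(enum_rank (J : ksub k n)) else 0.

(* For a < b < c < d, sorting the index words Lab and Lcd, Lac and Lbd, Lad and
   Lbc costs the same total sign, so the Grassmann-Plücker relation has, up to
   a global sign, the following form in the variables with sorted indices. *)
Definition three_term (R : realType) (k n : nat) (L : {set 'I_n})
    (a b c d : 'I_n) : {mpoly R[npl k n]} :=
  let p (x y : 'I_n) := pvar R k (L :|: [set x; y]) in
  p a b * p c d - p a c * p b d + p a d * p b c.

Definition plucker3 (R : realType) (k n : nat) : set {mpoly R[npl k n]} :=
  fun f => exists (L : {set 'I_n}) (a b c d : 'I_n),
    [/\ (#|L| + 2)%N = k,
        [&& (a < b)%N, (b < c)%N & (c < d)%N],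
        [disjoint L & [set a; b; c; d]]
      & f = three_term R k L a b c d].
Arguments plucker3 : clear implicits.

Local Open Scope classical_set_scope.

Definition chi_part (R : realType) (k n : nat) (chi : ksub k n -> R)
    (s : R) (f : {mpoly R[npl k n]}) : {mpoly R[npl k n]} :=
  \sum_(m <- msupp f |
        Num.sg ((f@_m *: 'X_[m]).@[fun i => chi (enum_val i)]) == s)
     f@_m *: 'X_[m].

Definition mdot (R : realType) (N : nat) (m : 'X_{1..N}) (x : 'rV[R]_N) : R :=
  \sum_(i < N) (m i)%:R * x 0 i.

Definition Trop (R : realType) (N : nat) (h : {mpoly R[N]}) (x : 'rV[R]_N) :
    \bar R :=
  \big[Order.min/+oo%E]_(m <- msupp h) (mdot m x)%:E.

Definition TropV (R : realType) (k n : nat) (chi : ksub k n -> R)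
    (f : {mpoly R[npl k n]}) : set 'rV[R]_(npl k n) :=
  [set x | Trop (chi_part chi 1 f) x = Trop (chi_part chi (-1) f) x].

Definition dressian (R : realType) (k n : nat) (chi : ksub k n -> R) :
    set 'rV[R]_(npl k n) :=
  \bigcap_(f in plucker3 R k n) TropV chi f.

Definition lin_map (R : realType) (k n : nat) (y : 'rV[R]_n) :
    'rV[R]_(npl k n) :=
  \row_(j < npl k n) \sum_(i in val (enum_val j : ksub k n)) y 0 i.

Definition lineality (R : realType) (k n : nat) : pred 'rV[R]_(npl k n) :=
  fun x => `[< exists y : 'rV[R]_n, x = lin_map k y >].

Lemma lineality_submod (R : realType) (k n : nat) :
  submod_closed (@lineality R k n).
Proof.
split; first by apply/asboolP; exists 0; apply/rowP => j;
  rewrite !mxE big1 // => i _; rewrite mxE.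
move=> a _ _ /asboolP[u ->] /asboolP[v ->]; apply/asboolP; exists (a *: u + v).
apply/rowP => j; rewrite !mxE mulr_sumr -big_split /=.
by apply: eq_bigr => i _; rewrite !mxE.
Qed.

HB.instance Definition _ (R : realType) (k n : nat) :=
  GRing.isSubmodClosed.Build R 'rV[R]_(npl k n) (@lineality R k n)
    (@lineality_submod R k n).

(* R^(npl k n) modulo the lineality space. The library only makes the quotient
   by a submodule a zmodType; we add the induced scaling. *)
Definition qspace (R : realType) (k n : nat) : Type :=
  Quotient.quot (GRing.ZmodClosed.clone _ (@lineality R k n) _).

HB.instance Definition _ (R : realType) (k n : nat) :=
  GRing.Zmodule.on (qspace R k n).
HB.instance Definition _ (R : realType) (k n : nat) :=
  ZmodQuotient.on (qspace R k n).

Definition qproj (R : realType) (k n : nat) (x : 'rV[R]_(npl k n)) :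
    qspace R k n :=
  \pi_(qspace R k n) x.

Lemma qprojD (R : realType) (k n : nat) : {morph @qproj R k n : x y / x + y}.
Proof. by move=> x y; exact: raddfD. Qed.

Lemma qproj_repr (R : realType) (k n : nat) (x : qspace R k n) :
  qproj (repr x) = x.
Proof. exact: reprK. Qed.

Lemma qprojP (R : realType) (k n : nat) (x y : 'rV[R]_(npl k n)) :
  qproj x = qproj y <-> exists z, x - y = lin_map k z.
Proof.
split=> [/eqP|[z xyz]]; last apply/eqP; rewrite /qproj -Quotient.idealrBE.
  by move=> /asboolP.
by apply/asboolP; exists z.
Qed.

Definition qscale (R : realType) (k n : nat) (a : R) (x : qspace R k n) :
    qspace R k n :=
  qproj (a *: repr x).

Lemma qscale_proj (R : realType) (k n : nat) (a : R) (v : 'rV[R]_(npl k n)) :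
  qscale a (qproj v) = qproj (a *: v).
Proof.
apply/eqP; rewrite /qscale /qproj -Quotient.idealrBE -scalerBr rpredZ //.
by rewrite Quotient.idealrBE reprK.
Qed.

Lemma qscaleA (R : realType) (k n : nat) (a b : R) (x : qspace R k n) :
  qscale a (qscale b x) = qscale (a * b) x.
Proof. by rewrite -[x]qproj_repr !qscale_proj scalerA. Qed.

Lemma qscale1 (R : realType) (k n : nat) : left_id 1 (@qscale R k n).
Proof. by move=> x; rewrite -[x]qproj_repr qscale_proj scale1r. Qed.

Lemma qscaleDr (R : realType) (k n : nat) :
  right_distributive (@qscale R k n) +%R.
Proof.
move=> a x y; rewrite -[x]qproj_repr -[y]qproj_repr -qprojD !qscale_proj.
by rewrite scalerDr qprojD.
Qed.

Lemma qscaleDl (R : realType) (k n : nat) (x : qspace R k n) :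
  {morph (@qscale R k n)^~ x : a b / a + b}.
Proof. by move=> a b; rewrite -[x]qproj_repr !qscale_proj scalerDl qprojD. Qed.

HB.instance Definition _ (R : realType) (k n : nat) :=
  GRing.Zmodule_isLmodule.Build R (qspace R k n)
    (@qscaleA R k n) (@qscale1 R k n) (@qscaleDr R k n) (@qscaleDl R k n).

Definition qdressian (R : realType) (k n : nat) (chi : ksub k n -> R) :
    set (qspace R k n) :=
  @qproj R k n @` dressian chi.

(* The closed cone containing w in its relative interior, in the common
   refinement of the normal fans of the Newton polytopes of the three-term
   relations. *)
Definition cell (R : realType) (k n : nat) (w : 'rV[R]_(npl k n)) :
    set 'rV[R]_(npl k n) :=
  [set x | forall f, plucker3 R k n f -> forall m, m \in msupp f ->
     (mdot m w)%:E = Trop f w -> (mdot m x)%:E = Trop f x].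

Definition fan_cone (R : realType) (k n : nat) (chi : ksub k n -> R)
    (C : set (qspace R k n)) : Prop :=
  exists2 w, dressian chi w & C = @qproj R k n @` cell w.

Definition maximal_cone (R : realType) (k n : nat) (chi : ksub k n -> R)
    (C : set (qspace R k n)) : Prop :=
  fan_cone chi C /\ forall D, fan_cone chi D -> C `<=` D -> D = C.

Definition lattice (R : realType) (k n : nat) : set (qspace R k n) :=
  [set qproj (map_mx intr z) | z in [set: 'rV[int]_(npl k n)]].

Definition primitive (R : realType) (k n : nat) (u : qspace R k n) : Prop :=
  [/\ lattice u, u != 0 &
      forall (q : nat) v, lattice v -> u = q%:R *: v -> q = 1%N].

Definition ray_generators (R : realType) (k n : nat) (chi : ksub k n -> R) :
    set (qspace R k n) :=
  [set u | primitive u /\ fan_cone chi [set t *: u | t in [set t : R | 0 <= t]]].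

Definition pairwise_compatible (R : realType) (k n : nat)
    (chi : ksub k n -> R) (S : {fset qspace R k n}) : Prop :=
  forall u v, u \in S -> v \in S -> qdressian chi (u + v).

Definition compatible_collection (R : realType) (k n : nat)
    (chi : ksub k n -> R) (S : {fset qspace R k n}) : Prop :=
  [set` S] `<=` ray_generators chi /\ pairwise_compatible chi S.

Definition maximal_compatible (R : realType) (k n : nat)
    (chi : ksub k n -> R) (S : {fset qspace R k n}) : Prop :=
  compatible_collection chi S /\
  forall T : {fset qspace R k n},
    compatible_collection chi T -> (S `<=` T)%fset -> T = S.

Definition cone_of (R : realType) (V : lmodType R) (S : {fset V}) : set V :=
  [set x | exists2 t : V -> R, (forall u, 0 <= t u) &
     x = \sum_(u <- S) t u *: u].

(* Main.v *)
(** Realizability forces one of the three terms of every three-term relation to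
    have the sign opposite to the two others; call it the single term.  A point
    then lies in the chirotropical Dressian iff, in each relation, the single
    term and at least one of the others attain the minimum.  Writing [tight x]
    for the set of all terms attaining the minimum at [x], the cell of [w] is
    [{x | tight w \subset tight x}].

    For two points of the Dressian whose sum is in the Dressian, the terms tight
    at the sum are those tight at both.  Pairwise compatible points thus share,
    in each relation, the single term and one of the other two (a pairwise
    intersecting family of nonempty subsets of a two-element set has a common
    element), so their sum [w] is in the Dressian and they all lie in the cell
    of [w].

    Modulo lineality every cell is a pointed rational cone: the points at which
    all terms are tight are exactly the lineality space.  Hence a cell is
    generated by its rays, each of which has a unique primitive generator, and a
    maximal compatible collection consists of all ray generators of one maximal
    cell. *)

From HB Require Import structures.
From mathcomp Require Import all_boot all_order all_algebra finmap.
From mathcomp Require Import mpoly ring lra zify.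
From mathcomp Require Import boolp classical_sets reals constructive_ereal.
Require Import Defs.

Set Implicit Arguments.
Unset Strict Implicit.
Unset Printing Implicit Defensive.

Import Order.TTheory GRing.Theory Num.Theory.

Local Open Scope ring_scope.

(** * The three-term relation for minors *)

Lemma enum_val_lt n (A : {set 'I_n}) (i j : 'I_#|A|) :
  (i < j)%N -> (enum_val i < enum_val j)%N.
Proof.
move=> ij; have x0 : 'I_n := enum_val i.
have srt : sorted (fun x y : 'I_n => x < y)%N (enum A).
  rewrite /enum_mem; apply: sorted_filter; first by move=> ? ? ?; apply: ltn_trans.
  by rewrite -enumT -(@sorted_map _ _ val ltn) val_enum_ord iota_ltn_sorted.
rewrite !(enum_val_nth x0); apply: (sorted_ltn_nth _ _ srt) => //.
- by move=> ? ? ?; apply: ltn_trans.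
- by rewrite inE -cardE.
- by rewrite inE -cardE.
Qed.

(** Both sequences are strictly increasing with value set [A], so they coincide. This identifies a
    choice of columns with the one made by [minor]. *)
Lemma increasing_enum_val n m (A : {set 'I_n}) (eqm : m = #|A|)
    (f : 'I_m -> 'I_n) :
  (forall s t : 'I_m, (s < t)%N -> (f s < f t)%N) ->
  (forall t, f t \in A) -> forall t, f t = enum_val (cast_ord eqm t).
Proof.
move=> fmono fA.
have injf : injective f.
  move=> s t est; apply/val_inj/eqP; case: ltngtP => // /fmono;
  by rewrite est ltnn.
suff e : codom f = codom (fun t => enum_val (cast_ord eqm t)).
  move=> t; have := congr1 (fun s => nth (f t) s (enum_rank t)) e.
  by rewrite !nth_codom !enum_rankK.
apply: (@irr_sorted_eq _ (fun x y : 'I_n => x < y)%N) => //.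
- by move=> ? ? ?; apply: ltn_trans.
- by move=> x; rewrite /= ltnn.
- rewrite /codom /image_mem sorted_map.
  apply: (@sub_sorted _ (fun x y : 'I_m => x < y)%N) => [s t|]; first exact: fmono.
  by rewrite -(@sorted_map _ _ val ltn) val_enum_ord iota_ltn_sorted.
- rewrite /codom /image_mem sorted_map.
  apply: (@sub_sorted _ (fun x y : 'I_m => x < y)%N) => [s t st|].
    exact: enum_val_lt.
  by rewrite -(@sorted_map _ _ val ltn) val_enum_ord iota_ltn_sorted.
- have subA : codom f \subset A.
    by apply/fintype.subsetP => x /codomP[t ->].
  have /subset_cardP/(_ subA) eA : #|codom f| = #|A|.
    by rewrite card_codom // card_ord.
  move=> x; rewrite eA; apply/idP/codomP => [xA|[t ->]]; last exact: enum_valP.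
  exists (cast_ord (esym eqm) (enum_rank_in xA x)).
  by rewrite cast_ordKV enum_rankK_in.
Qed.

Section TwoUnitRows.
Variables (F : fieldType) (k : nat) (h : 'M[F]_(k, k.+2)).

(** The unit vector of [j] comes first, which makes the sign in [det_bordered] exactly
    (-1)^(i+j). *)
Definition unit_rows (i j : 'I_k.+2) : 'M[F]_(2, k.+2) :=
  \matrix_(r, s) (s == if r == 0 then j else i)%:R.

Definition bordered (i j : 'I_k.+2) : 'M[F]_(2 + k) :=
  col_mx (unit_rows i j) h.

(** Laplace expansion along the two unit rows. As [i < j], deleting column [j] leaves the position
    of [i] unchanged, so the two exponents add up. *)
Lemma det_bordered (i j : 'I_k.+2) (i' : 'I_k.+1) : (i < j)%N -> lift j i' = i ->
  \det (bordered i j) =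
    (-1) ^+ (i + j) * \det (colsub (fun t => lift j (lift i' t)) h).
Proof.
move=> ij i'i; have vi' : i' = i :> nat.
  by move: (congr1 val i'i) ij => /=; rewrite /bump; case: leqP => /=; lia.
have row0 s : bordered i j 0 s = (s == j)%:R.
  have -> : (0 : 'I_(2 + k)) = lshift k 0 by apply/val_inj.
  by rewrite col_mxEu mxE eqxx.
have row1 s : bordered i j (lift 0 0) s = (s == i)%:R.
  have -> : (lift 0 0 : 'I_(2 + k)) = lshift k 1 by apply/val_inj.
  by rewrite col_mxEu mxE.
rewrite (expand_det_row _ 0) (bigD1 j) //= big1 => [|s sj]; last first.
  by rewrite row0 (negPf sj) mul0r.
rewrite row0 eqxx mul1r addr0 /cofactor /= add0n.
rewrite (expand_det_row _ 0) (bigD1 i') //= big1 => [|s si]; last first.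
  rewrite 2!mxE row1 -i'i (inj_eq (@lift_inj _ j)).
  by rewrite (negPf si) mul0r.
rewrite 2!mxE row1 i'i eqxx mul1r addr0 /cofactor add0n mulrA -exprD vi' addnC.
congr (_ * \det _); apply/matrixP => r s; rewrite !mxE.
have -> : lift 0 (lift 0 r) = rshift 2 r :> 'I_(2 + k) by apply/val_inj.
by rewrite (unsplitK (inr r)).
Qed.

(** With [Y] the inverse of [bordered a b], the product [h *m Y] is a zero block beside an identity.
    Hence each [bordered i j] has determinant [D] times a 2 by 2 minor of the first two columns of
    [Y], and for such minors the relation is a polynomial identity. *)
Lemma bordered_plucker (a b c d : 'I_k.+2) :
  \det (bordered a b) != 0 ->
  \det (bordered a b) * \det (bordered c d)
  - \det (bordered a c) * \det (bordered b d)
  + \det (bordered a d) * \det (bordered b c) = 0.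
Proof.
set P := bordered a b => dP; have uP : P \in unitmx by rewrite unitmxE unitfE.
pose Y := invmx P.
have decomp : exists D : F, forall i j, \det (bordered i j) =
    (Y j (lshift k 0) * Y i (lshift k 1) - Y j (lshift k 1) * Y i (lshift k 0))
    * D.
  exists (\det P) => i j.
  pose E := unit_rows i j *m Y.
  have hY : h *m Y = row_mx 0 1%:M.
    have : P *m Y = 1%:M by rewrite mulmxV.
    rewrite /P /bordered mul_col_mx (scalar_mx_block 2 k) block_mxEv.
    by move/eq_col_mx => [].
  have -> : bordered i j = block_mx (lsubmx E) (rsubmx E) 0 1%:M *m P.
    rewrite -[LHS](mulmxKV uP) -/Y; congr (_ *m _).
    by rewrite block_mxEv hsubmxK -hY -mul_col_mx.
  rewrite det_mulmx det_ublock det1 mulr1; congr (_ * _).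
  have -> : lsubmx E =
      \matrix_(r, s) Y (if r == 0 then j else i) (lshift k s).
    apply/matrixP => r s; rewrite mxE [LHS]mxE [RHS]mxE.
    rewrite (bigD1 (if r == 0 then j else i)) //= mxE eqxx mul1r big1 ?addr0 //.
    by move=> s' ns'; rewrite mxE (negPf ns') mul0r.
  move: (Y) => Z.
  rewrite (expand_det_row _ 0) !big_ord_recl big_ord0 /= addr0 /cofactor.
  rewrite /= !det_mx11 !mxE /= expr0 expr1 !mul1r mulN1r mulrN.
  by congr (_ * Z _ _ - Z _ _ * Z _ _); apply/val_inj.
have [D detE] := decomp; rewrite !detE; ring.
Qed.

End TwoUnitRows.

Lemma lift_lt m (h : 'I_m.+1) (x y : 'I_m) :
  (x < y)%N -> (lift h x < lift h y)%N.
Proof.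
by move=> xy /=; rewrite /bump; case: (leqP h x); case: (leqP h y); lia.
Qed.

Lemma card_setU_pair (k n : nat) (L : {set 'I_n}) (x y : 'I_n) :
  (#|L| + 2)%N = k -> x \notin L -> y \notin L -> x != y ->
  #|L :|: [set x; y]| = k.
Proof.
move=> <- xL yL xy.
rewrite cardsU (_ : L :&: _ = finset.set0) ?cards0 ?subn0 ?cards2 ?xy //.
apply/setP => u; rewrite !inE; apply/negbTE/negP => /andP[uL].
by case/orP => /eqP eu; move: uL; rewrite eu ?(negPf xL) ?(negPf yL).
Qed.

Section PluckerRelation.
Variables (R : realType) (k n : nat) (g : 'M[R]_(k, n)).

(* Junk value 0 on sets of the wrong size. *)
Definition set_minor (A : {set 'I_n}) : R :=
  if (insub A : option (ksub k n)) is Some J then minor g J else 0.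

Lemma set_minorE (I : ksub k n) : set_minor (val I) = minor g I.
Proof. by rewrite /set_minor valK. Qed.

(** After columns [i] and [j] are deleted, [e] enumerates the rest of [M] increasingly, which is the
    column order of [minor]. *)
Lemma det_bordered_minor (M : {set 'I_n}) (eqM : k.+2 = #|M|)
    (e := fun t => enum_val (cast_ord eqM t)) (i j : 'I_k.+2) : (i < j)%N ->
  \det (bordered (colsub e g) i j) =
    (-1) ^+ (i + j) * set_minor (M :\: [set e i; e j]).
Proof.
move=> ij.
have eM t : e t \in M by exact: enum_valP.
have emono (s t : 'I_k.+2) : (s < t)%N -> (e s < e t)%N by move=> st; apply: enum_val_lt.
have einj : injective e by move=> s t /enum_val_inj/cast_ord_inj.
have [i' i'i] : exists i', lift j i' = i.
  have : i != j by rewrite neq_ltn ij.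
  by case: (unliftP j i) => [i' ->|->]; rewrite ?eqxx //; exists i'.
rewrite (det_bordered _ ij i'i); congr (_ * _).
have cA : #|M :\: [set e i; e j]| == k.
  rewrite cardsD (finset.setIidPr _) -?eqM ?cards2.
    by rewrite (inj_eq einj) neq_ltn ij /= subn2.
  by rewrite finset.subUset !finset.sub1set !eM.
rewrite /set_minor insubT /minor.
congr (\det _); apply/matrixP => r s; rewrite !mxE; congr (g _ _).
apply: (@increasing_enum_val _ _ _ _ (fun s => e (lift j (lift i' s)))).
- by move=> t u tu; apply: emono; do 2 apply: lift_lt.
- move=> t; rewrite !inE eM andbT negb_or !(inj_eq einj) -{1}i'i.
  by rewrite (inj_eq lift_inj) !(eq_sym (lift _ _)) !neq_lift.
Qed.

Hypothesis g_uniform : forall I : ksub k n, minor g I != 0.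

(** Restrict [g] to the k+2 columns in [M], the union of [L] and the four indices. Complements in
    [M] exchange the two factors of each product, and all three products carry the same sign. *)
Lemma minor_three_term (L : {set 'I_n}) (a b c d : 'I_n)
    (p := fun x y => set_minor (L :|: [set x; y])) :
  (#|L| + 2)%N = k -> [&& (a < b)%N, (b < c)%N & (c < d)%N] ->
  [disjoint L & [set a; b; c; d]] ->
  p a b * p c d - p a c * p b d + p a d * p b c = 0.
Proof.
move=> cL /and3P[ab bc cd] dL.
have /and4P[aL bL cNL dNL] : [&& a \notin L, b \notin L, c \notin L & d \notin L].
  move: dL; rewrite disjoint_sym => /disjointFr dL.
  by rewrite !dL // !inE eqxx ?orbT.
have neqs : (a != b) && (a != c) && (a != d) && (b != c) && (b != d) && (c != d).
  by rewrite !neq_ltn ab bc cd (ltn_trans ab bc) (ltn_trans bc cd)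
     (ltn_trans ab (ltn_trans bc cd)).
pose M := L :|: [set a; b; c; d].
have eqM : k.+2 = #|M|.
  rewrite cardsU (_ : L :&: _ = finset.set0) ?cards0 ?subn0; last first.
    by apply/eqP; rewrite finset.setI_eq0.
  rewrite -cL -!finset.setUA !cardsU1 !inE cards1 !negb_or.
  by move: neqs; do 5 ![case/andP]; do 6 ![move->]; lia.
pose e t := enum_val (cast_ord eqM t).
have eM x : x \in M -> exists t, e t = x.
  move=> xM; exists (cast_ord (esym eqM) (enum_rank_in xM x)).
  by rewrite /e cast_ordKV enum_rankK_in.
have [|i ei] := eM a; first by rewrite !inE eqxx ?orbT.
have [|j ej] := eM b; first by rewrite !inE eqxx ?orbT.
have [|l el] := eM c; first by rewrite !inE eqxx ?orbT.
have [|m em] := eM d; first by rewrite !inE eqxx ?orbT.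
have elt (s t : 'I_k.+2) : (e s < e t)%N -> (s < t)%N.
  case: (ltngtP s t) => // [ts|/val_inj ->]; last by rewrite ltnn.
  move=> est; have lt_ts : (e t < e s)%N by apply: enum_val_lt.
  by have := ltn_trans est lt_ts; rewrite ltnn.
have ij : (i < j)%N by apply: elt; rewrite ei ej.
have jl : (j < l)%N by apply: elt; rewrite ej el.
have lm : (l < m)%N by apply: elt; rewrite el em.
have compl x y z t : [set a; b; c; d] = [set x; y; z; t] ->
    (x != z) && (x != t) && (y != z) && (y != t) && (x \notin L) && (y \notin L) ->
    M :\: [set x; y] = L :|: [set z; t].
  move=> abcd; do 5 ![case/andP]; move=> xz xt yz yt xL yL; rewrite /M abcd.
  apply/setP => u; rewrite !inE.
  have [->|ux] := eqVneq u x; first by rewrite (negPf xL) (negPf xz) (negPf xt).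
  have [->|uy] := eqVneq u y; first by rewrite (negPf yL) (negPf yz) (negPf yt).
  by [].
have detE (s t : 'I_k.+2) : (s < t)%N -> \det (bordered (colsub e g) s t) =
    (-1) ^+ (s + t) * set_minor (M :\: [set e s; e t]).
  exact: det_bordered_minor.
have il := ltn_trans ij jl; have jm := ltn_trans jl lm.
have := @bordered_plucker _ _ (colsub e g) i j l m.
rewrite (detE i j) // (detE l m) // (detE i l) // (detE j m) // (detE j l) //.
rewrite (detE i m) ?(ltn_trans il lm) // ei ej el em.
move: neqs; do 5 ![case/andP]; move=> nab nac nad nbc nbd ncd.
rewrite (compl a b c d) //; last by do ?[apply/andP; split]; rewrite // eq_sym.
rewrite (compl c d a b) //; last 2 first.
- by apply/setP => u; rewrite !inE; do 4 case: (u == _).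
- by do ?[apply/andP; split]; rewrite // eq_sym.
rewrite (compl a c b d) //; last 2 first.
- by apply/setP => u; rewrite !inE; do 4 case: (u == _).
- by do ?[apply/andP; split]; rewrite // eq_sym.
rewrite (compl b d a c) //; last 2 first.
- by apply/setP => u; rewrite !inE; do 4 case: (u == _).
- by do ?[apply/andP; split]; rewrite // eq_sym.
rewrite (compl a d b c) //; last 2 first.
- by apply/setP => u; rewrite !inE; do 4 case: (u == _).
- by do ?[apply/andP; split]; rewrite // eq_sym.
rewrite (compl b c a d) //; last 2 first.
- by apply/setP => u; rewrite !inE; do 4 case: (u == _).
- by do ?[apply/andP; split]; rewrite // eq_sym.
rewrite -!/(p _ _) => rel.
(* By complementation, the determinant that has to be nonzero in [bordered_plucker] is this minor up
   to sign. *)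
have pcd : p c d != 0.
  have cI : #|L :|: [set c; d]| == k by apply/eqP; exact: card_setU_pair.
  by rewrite /p /set_minor insubT.
have sgn0 s : (-1) ^+ s != 0 :> R by rewrite signr_eq0.
have {rel} /eqP := rel (mulf_neq0 (sgn0 _) pcd).
rewrite (_ : _ + _ = (-1) ^+ (i + j + l + m) *
   (p a b * p c d - p a c * p b d + p a d * p b c)); last first.
  by rewrite !exprD; ring.
by rewrite mulf_eq0 (negPf (sgn0 _)) => /eqP.
Qed.

End PluckerRelation.

(** * Tight terms, cells and the Dressian *)

Section Relations.
Variables (k n : nat).

Definition quad : Type := ({set 'I_n} * ('I_n * 'I_n * 'I_n * 'I_n))%type.

Definition is_relation (q : quad) : bool :=
  let: (L, (a, b, c, d)) := q in
  [&& (#|L| + 2)%N == k, (a < b)%N, (b < c)%N, (c < d)%N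
    & [disjoint L & [set a; b; c; d]]].

(** Made a finite type, so that tight terms form finite sets, comparable by inclusion and
    cardinality. *)
Definition relation : Type := {q : quad | is_relation q}.
HB.instance Definition _ := Finite.on relation.
HB.instance Definition _ := SubType.on relation.

(* The second component is the one not containing a. *)
Definition term_sets (q : quad) (i : 'I_3) : {set 'I_n} * {set 'I_n} :=
  let: (L, (a, b, c, d)) := q in
  match val i with
  | 0%N => (L :|: [set a; b], L :|: [set c; d])
  | 1%N => (L :|: [set a; c], L :|: [set b; d])
  | _ => (L :|: [set a; d], L :|: [set b; c])
  end.

Lemma is_relationP (L : {set 'I_n}) (a b c d : 'I_n) :
  is_relation (L, (a, b, c, d)) ->
  [/\ (#|L| + 2)%N = k, [&& (a < b)%N, (b < c)%N & (c < d)%N],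
     [disjoint L & [set a; b; c; d]],
     [&& a \notin L, b \notin L, c \notin L & d \notin L]
   & [&& a != b, a != c, a != d, b != c, b != d & c != d]].
Proof.
case/and5P=> /eqP cL ab bc cd dL; split=> //; first by rewrite ab bc cd.
  move: (dL); rewrite disjoint_sym => /disjointFr dL'.
  by rewrite !dL' // !inE eqxx ?orbT.
by rewrite !neq_ltn ab bc cd (ltn_trans ab bc) (ltn_trans bc cd)
  (ltn_trans ab (ltn_trans bc cd)).
Qed.

Lemma card_term_sets (q : relation) i :
  #|(term_sets (val q) i).1| = k /\ #|(term_sets (val q) i).2| = k.
Proof.
case: q => -[L [[[a b] c] d]] /= /is_relationP[cL _ _].
case/and4P=> aL bL cNL dL /and5P[ab ac ad bc /andP[bd cd]].
by case: i => [[|[|i]] ?] /=; split; apply: card_setU_pair.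
Qed.

Lemma ksub_of_set (A : {set 'I_n}) : #|A| = k ->
  exists J : ksub k n, A = val J.
Proof.
by move=> /eqP cA; exists (exist (fun B : {set 'I_n} => #|B| == k) A cA).
Qed.

(* Junk value 0 on sets of the wrong size. *)
Definition set_mnm (A : {set 'I_n}) : 'X_{1..npl k n} :=
  if (insub A : option (ksub k n)) is Some J then U_(enum_rank J)%MM else 0%MM.

Lemma set_mnmE (J : ksub k n) : set_mnm (val J) = U_(enum_rank J)%MM.
Proof. by rewrite /set_mnm valK. Qed.

Definition term_mnm (q : relation) (i : 'I_3) : 'X_{1..npl k n} :=
  (set_mnm (term_sets (val q) i).1 + set_mnm (term_sets (val q) i).2)%MM.

Lemma term_mnmP (q : relation) i : exists J1 J2 : ksub k n,
  [/\ (term_sets (val q) i).1 = val J1, (term_sets (val q) i).2 = val J2 &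
      term_mnm q i = (U_(enum_rank J1) + U_(enum_rank J2))%MM].
Proof.
have [/ksub_of_set[J1 e1] /ksub_of_set[J2 e2]] := card_term_sets q i.
by exists J1, J2; rewrite /term_mnm e1 e2 !set_mnmE.
Qed.

(** The first set of every term contains [a] and no second set does; the partner of [a] tells the
    terms apart. *)
Lemma term_sets_inj (q : relation) i i' :
  (term_sets (val q) i).1 = (term_sets (val q) i').1 \/
  (term_sets (val q) i).1 = (term_sets (val q) i').2 -> i = i'.
Proof.
case: q => -[L [[[a b] c] d]] /= /is_relationP[cL _ _].
case/and4P=> aL bL cNL dL /and5P[ab ac ad bc /andP[bd cd]].
move=> eqs; apply/val_inj; move: eqs.
case: i => [[|[|[|i]]] ?] //=; case: i' => [[|[|[|i']]] ?] //=;
  case=> /setP e; move: (e a) (e b) (e c) (e d);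
  rewrite !inE ?eqxx ?orbT ?(negPf aL) ?(negPf bL) ?(negPf cNL) ?(negPf dL) /=;
  rewrite ?[c == b]eq_sym ?[d == b]eq_sym ?[d == c]eq_sym ?[b == a]eq_sym
   ?[c == a]eq_sym ?[d == a]eq_sym
   ?(negPf ab) ?(negPf ac) ?(negPf ad) ?(negPf bc) ?(negPf bd) ?(negPf cd) //.
Qed.

(** Consequently no two terms of a relation merge or cancel. *)
Lemma term_mnm_inj q : injective (term_mnm q).
Proof.
move=> i i'; have [J1 [J2 [e1 e2 ->]]] := term_mnmP q i.
have [J1' [J2' [e1' e2' ->]]] := term_mnmP q i'.
move/(congr1 (fun m : 'X_{1.._} => m (enum_rank J1))).
rewrite !mnmDE !mnm1E eqxx !(inj_eq enum_rank_inj) => h.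
apply: (@term_sets_inj q); rewrite e1 e1' e2'; move: h.
case: (eqVneq J1' J1) => [->|_]; first by left.
by case: (eqVneq J2' J1) => [->|_]; first by right.
Qed.

End Relations.

(** * Three-term relations as polynomials, and membership in the Dressian through tight terms *)

Section Polynomials.
Variables (R : realType) (k n : nat).
Implicit Types (q : relation k n) (x w : 'rV[R]_(npl k n)).

Definition relation_poly q : {mpoly R[npl k n]} :=
  \sum_(i < 3) (-1) ^+ i *: 'X_[term_mnm q i].

Lemma pvarE (A : {set 'I_n}) : #|A| = k -> pvar R k A = 'X_[set_mnm k A].
Proof. by move=> /ksub_of_set[J ->]; rewrite /pvar set_mnmE valK. Qed.

Lemma plucker3P (f : {mpoly R[npl k n]}) :
  plucker3 R k n f <-> exists q, f = relation_poly q.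
Proof.
have polyE L a b c d (rel : is_relation k (L, (a, b, c, d))) :
    relation_poly (exist (@is_relation k n) _ rel) = three_term R k L a b c d.
  have [cL _ _] := is_relationP rel.
  case/and4P=> aL bL cNL dL /and5P[ab ac ad bc /andP[bd cd]].
  rewrite /relation_poly !big_ord_recl big_ord0 addr0 /three_term /term_mnm /=.
  rewrite !pvarE; try exact: card_setU_pair.
  by rewrite !mpolyXD expr0 expr1 scale1r scaleN1r exprS expr1 mulrNN mulr1
    scale1r addrA.
split=> [[L [a [b [c [d [cL abcd dL ->]]]]]]|[[[L [[[a b] c] d]] rel] ->]].
  have rel : is_relation k (L, (a, b, c, d)).
    by case/and3P: abcd => ab bc cd; rewrite /is_relation cL eqxx ab bc cd.
  by exists (exist (@is_relation k n) _ rel).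
have [cL abcd dL _ _] := is_relationP rel.
by exists L, a, b, c, d; split=> //; exact: polyE.
Qed.

Lemma mcoeff_relation_poly q i : (relation_poly q)@_(term_mnm q i) = (-1) ^+ i.
Proof.
rewrite /relation_poly raddf_sum /= (bigD1 i) //= big1 => [|j ji].
  by rewrite mcoeffZ mcoeffX eqxx mulr1 addr0.
by rewrite mcoeffZ mcoeffX (inj_eq (@term_mnm_inj _ _ q)) (negPf ji) mulr0.
Qed.

Lemma msupp_relation_polyP q (m : 'X_{1..npl k n}) :
  reflect (exists i, m = term_mnm q i) (m \in msupp (relation_poly q)).
Proof.
apply: (iffP idP) => [|[i ->]]; last first.
  by rewrite mcoeff_msupp mcoeff_relation_poly signr_eq0.
apply: contraPP => /forallNP nm; apply/negP; rewrite mcoeff_msupp negbK.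
rewrite /relation_poly raddf_sum /= big1 // => i _.
by rewrite mcoeffZ mcoeffX; case: eqP => [e|]; rewrite ?mulr0 //; case: (nm i).
Qed.

Lemma bigmin_ereal (T : eqType) (s : seq T) (F : T -> R)
    (mu := (\big[Order.min/+oo%E]_(m <- s) (F m)%:E)%E) :
  (forall m, m \in s -> (mu <= (F m)%:E)%E) /\
  (mu = +oo%E /\ s = [::] \/ exists2 m, m \in s & mu = (F m)%:E).
Proof.
rewrite {}/mu; elim: s => [|m s [IH1 IH2]]; first by rewrite big_nil; split; [|left].
rewrite big_cons; split=> [m'|].
  rewrite inE => /orP[/eqP ->|/IH1 h]; first by rewrite ge_min lexx.
  by rewrite ge_min h orbT.
right; case: IH2 => [[-> ->]|[m' m's ->]].
  by exists m; rewrite ?inE ?eqxx // min_l // leey.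
rewrite minEle; case: ifP => _; first by exists m; rewrite ?inE ?eqxx.
by exists m' => //; rewrite inE m's orbT.
Qed.

Lemma Trop_attained N (h : {mpoly R[N]}) (v : 'rV[R]_N) m : m \in msupp h ->
  ((mdot m v)%:E = Trop h v <->
   forall m', m' \in msupp h -> mdot m v <= mdot m' v).
Proof.
move=> mh; have [minle attained] := bigmin_ereal (msupp h) (fun m' => mdot m' v).
rewrite -/(Trop h v) in minle attained; split=> [mE m' m'h|mle].
  by rewrite -lee_fin mE minle.
apply/eqP; rewrite eq_le minle // andbT.
by case: attained => [[-> _]|[m' m'h ->]]; rewrite ?leey // lee_fin mle.
Qed.

Definition tight x : {set relation k n * 'I_3} :=
  [set p | [forall i, mdot (term_mnm p.1 p.2) x <= mdot (term_mnm p.1 i) x]].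

Lemma tightP x q i :
  reflect (forall j, mdot (term_mnm q i) x <= mdot (term_mnm q j) x)
    ((q, i) \in tight x).
Proof. by rewrite inE; exact: forallP. Qed.

Lemma tight_eq x q i j : (q, i) \in tight x -> (q, j) \in tight x ->
  mdot (term_mnm q i) x = mdot (term_mnm q j) x.
Proof. by move=> /tightP qi /tightP qj; apply/le_anti; rewrite qi qj. Qed.

Lemma tight_of_eq x q i j : (q, i) \in tight x ->
  mdot (term_mnm q j) x = mdot (term_mnm q i) x -> (q, j) \in tight x.
Proof. by move=> /tightP qi e; apply/tightP => l; rewrite e. Qed.

Lemma tight_ex x q : exists i, (q, i) \in tight x.
Proof.
have [i _ imin] := arg_minP (fun i => mdot (term_mnm q i) x) (erefl (predT ord0)).
by exists i; apply/tightP => j; exact: imin.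
Qed.

Lemma tight_Trop x q i : (mdot (term_mnm q i) x)%:E = Trop (relation_poly q) x <->
  (q, i) \in tight x.
Proof.
rewrite Trop_attained; last by apply/msupp_relation_polyP; exists i.
split=> [h|/tightP h _ /msupp_relation_polyP[j ->] //].
by apply/tightP => j; apply: h; apply/msupp_relation_polyP; exists j.
Qed.

Lemma cellP w x : cell w x <-> tight w \subset tight x.
Proof.
split=> [cwx|/fintype.subsetP sub f /plucker3P[q ->] m].
  apply/fintype.subsetP => -[q i] /tight_Trop qi; apply/tight_Trop.
  by apply: (cwx _ _ _ _ qi); [apply/plucker3P; exists q|
    apply/msupp_relation_polyP; exists i].
by move=> /msupp_relation_polyP[i ->] /tight_Trop /sub /tight_Trop.
Qed.

Variable chi : ksub k n -> R.

Definition term_sign q (i : 'I_3) : R :=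
  Num.sg (((-1) ^+ i *: 'X_[term_mnm q i]).@[fun j => chi (enum_val j)]).

Lemma msupp_chi_partP q s (m : 'X_{1..npl k n}) :
  reflect (exists2 i, m = term_mnm q i & term_sign q i = s)
    (m \in msupp (chi_part chi s (relation_poly q))).
Proof.
rewrite mcoeff_msupp /chi_part raddf_sum /=.
have termE i : Num.sg (((relation_poly q)@_(term_mnm q i) *:
    'X_[term_mnm q i]).@[fun j => chi (enum_val j)]) = term_sign q i.
  by rewrite mcoeff_relation_poly.
apply: (iffP idP) => [|[i -> si]].
  apply: contraPP => ns; apply/negP; rewrite negbK big_seq_cond big1 // => m'.
  case/andP=> /msupp_relation_polyP[i ->]; rewrite termE => /eqP si.
  rewrite mcoeffZ mcoeffX; case: eqP => [e|]; rewrite ?mulr0 //.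
  by case: ns; exists i.
rewrite big_mkcond (bigD1_seq (term_mnm q i)) /=; last 2 first.
- by apply/msupp_relation_polyP; exists i.
- exact: msupp_uniq.
rewrite termE si eqxx mcoeffZ mcoeffX eqxx mulr1 mcoeff_relation_poly.
rewrite big1 ?addr0 ?signr_eq0 // => m' nm'; case: ifP => // _.
by rewrite mcoeffZ mcoeffX (negPf nm') mulr0.
Qed.

Hypothesis chi_real : realizable_uniform_chirotope chi.

Lemma term_sign_cases q i : term_sign q i = 1 \/ term_sign q i = -1.
Proof.
have [g gP] := chi_real; have [J1 [J2 [_ _ e]]] := term_mnmP q i.
suff : term_sign q i != 0.
  by rewrite /term_sign; case: sgrP; rewrite ?eqxx //; [left|right].
rewrite /term_sign e mpolyXD mevalZ mevalM !mevalXU !enum_rankK sgr_eq0.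
by rewrite !mulf_eq0 signr_eq0 /= !(gP _).2 !sgr_eq0 !(negPf (gP _).1).
Qed.

(** For a matrix realizing [chi], the signed products of minors are nonzero and sum to zero by the
    three-term relation, so both signs occur. *)
Lemma term_sign_mixed q : exists i j, term_sign q i = 1 /\ term_sign q j = -1.
Proof.
have [g gP] := chi_real.
pose v (i : 'I_3) := (-1) ^+ i * (set_minor g (term_sets (val q) i).1 *
                         set_minor g (term_sets (val q) i).2).
have signE (i : 'I_3) : term_sign q i = Num.sg (v i).
  have [J1 [J2 [e1 e2 e]]] := term_mnmP q i.
  rewrite /v e1 e2 !set_minorE /term_sign e mpolyXD mevalZ mevalM !mevalXU.
  by rewrite !enum_rankK !(gP _).2 !sgrM !sgr_id.
have sum0 : \sum_(i < 3) v i = 0.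
  rewrite !big_ord_recl big_ord0 addr0 /v.
  case: q {v signE} => -[L [[[a b] c] d]] /= rel.
  have [cL abcd dL _ _] := is_relationP rel.
  have := minor_three_term (fun I => (gP I).1) cL abcd dL.
  by rewrite expr0 expr1 exprS expr1 mulrNN mulr1 !mul1r mulN1r addrA.
have cases i := term_sign_cases q i.
have [[i si]|np] := pselect (exists i, term_sign q i = 1); last first.
  have vneg i : v i < 0.
    have [si|] := cases i; first by case: np; exists i.
    by rewrite signE => /eqP; rewrite sgr_cp0.
  by move: sum0; rewrite !big_ord_recl big_ord0 addr0;
     have := vneg 0; have := vneg (lift 0 0); have := vneg (lift 0 (lift 0 0)); lra.
have [[j sj]|nn] := pselect (exists j, term_sign q j = -1); first by exists i, j.
have vpos j : 0 < v j.
  have [|sj] := cases j; last by case: nn; exists j.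
  by rewrite signE => /eqP; rewrite sgr_cp0.
by move: sum0; rewrite !big_ord_recl big_ord0 addr0;
   have := vpos 0; have := vpos (lift 0 0); have := vpos (lift 0 (lift 0 0)); lra.
Qed.

(** Some term attains the overall minimum; it computes the tropical value of the part of its own
    sign. Equality of the two values then says that a term of the other sign attains the minimum
    too. *)
Lemma dressianP x : dressian chi x <->
  forall q, exists i j, [/\ term_sign q i = 1, term_sign q j = -1,
    (q, i) \in tight x & (q, j) \in tight x].
Proof.
have TropE q i s : term_sign q i = s -> (q, i) \in tight x ->
    Trop (chi_part chi s (relation_poly q)) x = (mdot (term_mnm q i) x)%:E.
  move=> si /tightP qi; apply/esym/Trop_attained.
    by apply/msupp_chi_partP; exists i.
  by move=> _ /msupp_chi_partP[j -> _].
have flip q i s t : term_sign q i = s -> (q, i) \in tight x ->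
    Trop (chi_part chi s (relation_poly q)) x =
    Trop (chi_part chi t (relation_poly q)) x ->
    exists2 j, term_sign q j = t & (q, j) \in tight x.
  move=> si qi; rewrite (TropE _ _ _ si qi) => e.
  have [_] := bigmin_ereal (msupp (chi_part chi t (relation_poly q))) (fun m' => mdot m' x).
  rewrite -/(Trop _ x) -e => -[[]//|[_ /msupp_chi_partP[j -> sj] [ej]]].
  by exists j => //; apply: tight_of_eq qi _.
split=> [Dx q|h f /plucker3P[q ->]].
  have {Dx} e : TropV chi (relation_poly q) x by apply: Dx; apply/plucker3P; exists q.
  have [i qi] := tight_ex x q; have [si|si] := term_sign_cases q i.
    by have [j sj qj] := flip _ _ _ _ si qi e; exists i, j.
  by have [j sj qj] := flip _ _ _ _ si qi (esym e); exists j, i.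
have [i [j [si sj qi qj]]] := h q.
by rewrite /TropV /= (TropE _ _ _ si qi) (TropE _ _ _ sj qj) (tight_eq qi qj).
Qed.

End Polynomials.

(** * The lineality space *)

Section FlatSetFunctions.
Variables (R : realType) (k n : nat).

(** All three pairings give equal sums: the quadruple is not ordered, so exchanging [c] and [d]
    yields the second equality. *)
Definition flat_set_function (F : {set 'I_n} -> R) : Prop :=
  forall (L : {set 'I_n}) (a b c d : 'I_n), (#|L| + 2)%N = k ->
    [&& a \notin L, b \notin L, c \notin L & d \notin L] ->
    [&& a != b, a != c, a != d, b != c, b != d & c != d] ->
    F (L :|: [set a; b]) + F (L :|: [set c; d]) =
    F (L :|: [set a; c]) + F (L :|: [set b; d]).

Lemma card_setD_sym (A B : {set 'I_n}) : #|A| = #|B| -> #|A :\: B| = #|B :\: A|.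
Proof. by move=> AB; rewrite !cardsD AB finset.setIC. Qed.

(* Induction on #|A :\: I0|: two elements of A outside I0 are exchanged for two
   elements of I0 outside A, and the other three sets in the resulting relation
   are closer to I0. *)
Lemma flat_vanish (F : {set 'I_n} -> R) (I0 : {set 'I_n}) :
  flat_set_function F -> #|I0| = k -> F I0 = 0 ->
  (forall a b, a \in I0 -> b \notin I0 -> F (b |: (I0 :\ a)) = 0) ->
  forall A : {set 'I_n}, #|A| = k -> F A = 0.
Proof.
move=> flatF cI0 F0 F1 A; have [m] := ubnP #|A :\: I0|.
elim: m A => // m IHm A; rewrite ltnS => leAm cA.
have cDA := card_setD_sym (etrans cA (esym cI0)).
have [/eqP|] := posnP #|A :\: I0|.
  rewrite cards_eq0 finset.setD_eq0 => sA.
  by have /eqP -> : A == I0 by rewrite eqEcard sA cA cI0 leqnn.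
rewrite leq_eqVlt => /orP[/eqP c1|c2].
  have /eqP/cards1P[b eb] := esym c1.
  have /eqP/cards1P[a ea] : #|I0 :\: A| = 1%N by rewrite -cDA -c1.
  have /setDP[bA bI] : b \in A :\: I0 by rewrite eb set11.
  have /setDP[aI aA] : a \in I0 :\: A by rewrite ea set11.
  have -> : A = b |: (I0 :\ a); last exact: F1.
  apply/setP => u; rewrite !inE.
  have := congr1 (fun B : {set 'I_n} => u \in B) eb.
  have := congr1 (fun B : {set 'I_n} => u \in B) ea.
  rewrite !inE; case: (eqVneq u a) => [->|_].
    by rewrite (negPf aA); case: eqP aI bI => [->->|].
  by case: (u \in A); case: (u \in I0) => //= _ <-.
have [b [b' [/setDP[bA bI] /setDP[b'A b'I] bb']]] := card_gt1P c2.
rewrite cDA in c2.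
have [a [a' [/setDP[aI aA] /setDP[a'I a'A] aa']]] := card_gt1P c2.
pose L := A :\ b :\ b'.
have cL : (#|L| + 2)%N = k.
  by rewrite -cA (cardsD1 b A) bA (cardsD1 b' (A :\ b)) !inE eq_sym bb' b'A addnC.
have AE : A = L :|: [set b; b'].
  apply/setP => u; rewrite !inE.
  by case: (eqVneq u b) => [->|]; rewrite ?bA ?orbT //;
     case: (eqVneq u b') => [->|]; rewrite ?b'A ?orbT //= orbF.
have neq x y : x \in I0 -> y \notin I0 -> x != y.
  by move=> xI yI; apply: contraNneq yI => <-.
(* The difference of this set from [I0] is contained in that of [A] and misses [z], so the induction
   hypothesis applies. *)
have closer x y z : x \in I0 -> x \notin A -> y \notin L ->
    (y \in A) || (y \in I0) -> z \in A -> z \notin I0 -> z \notin L ->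
    z != y -> x != y ->
    F (L :|: [set x; y]) = 0.
  move=> xI xA yL yAI zA zI zL zy xy; apply: IHm; last first.
    by apply: card_setU_pair => //; rewrite !inE (negPf xA) !andbF.
  apply: leq_trans leAm; apply: proper_card; apply/properP; split.
    apply/fintype.subsetP => u; rewrite !inE => /andP[uI].
    rewrite uI /= => /orP[/and3P[] //|/orP[/eqP ux|/eqP uy]].
      by rewrite ux xI in uI.
    by move: yAI; rewrite -uy (negPf uI) orbF.
  exists z; rewrite finset.in_setD ?zI ?zA // finset.in_setU finset.in_set2 (negPf zL) (negPf zy) orbF.
  by rewrite [z == x]eq_sym (negPf (neq _ _ xI zI)) andbF.
have bL : b \notin L by rewrite !inE eqxx andbF.
have b'L : b' \notin L by rewrite !inE eqxx.
have aL : a \notin L by rewrite !inE (negPf aA) !andbF.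
have a'L : a' \notin L by rewrite !inE (negPf a'A) !andbF.
have := flatF L b b' a a' cL.
rewrite aL a'L bL b'L bb' aa' ![b == _]eq_sym ![b' == _]eq_sym !neq //= -AE.
move=> /(_ isT isT).
rewrite [[set b; a]]finset.setUC [[set b'; a']]finset.setUC.
have -> : F (L :|: [set a; a']) = 0.
  by apply: (closer a a' b); rewrite ?a'I ?orbT // eq_sym neq.
have -> : F (L :|: [set a; b]) = 0.
  by apply: (closer a b b'); rewrite ?bA ?(neq a b) // eq_sym.
have -> : F (L :|: [set a'; b']) = 0.
  by apply: (closer a' b' b); rewrite ?b'A ?(neq a' b').
by rewrite !addr0.
Qed.

Lemma sum_setU_pair (y : 'I_n -> R) (L : {set 'I_n}) (a b : 'I_n) :
  a \notin L -> b \notin L -> a != b ->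
  \sum_(i in L :|: [set a; b]) y i = \sum_(i in L) y i + y a + y b.
Proof.
move=> aL bL ab; rewrite finset.setUC -finset.setUA.
rewrite big_setU1 ?inE ?negb_or ?ab ?aL //= big_setU1 //=.
by rewrite addrA addrC addrA.
Qed.

(** Weights are read off from the exchanges of one element at a base set [I0]. Subtracting their
    sums from [F] leaves a flat function that vanishes at [I0] and its neighbours, hence on all
    k-sets by [flat_vanish]. *)
Lemma flat_set_function_additive (F : {set 'I_n} -> R) : (0 < k)%N ->
  flat_set_function F -> exists y : 'I_n -> R, forall A : {set 'I_n}, #|A| = k ->
    F A = \sum_(i in A) y i.
Proof.
move=> k0 flatF.
have [[I0 cI0]|noI0] := pselect (exists A : {set 'I_n}, #|A| = k); last first.
  by exists (fun=> 0) => A cA; case: noI0; exists A.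
have [a0 a0I] : exists a, a \in I0 by apply/card_gt0P; rewrite cI0.
(* The default [a0] is taken only when [I0] is the whole ground set; then there is no exchange to
   check. *)
pose b0 := odflt a0 [pick b | b \notin I0].
have b0P b : b \notin I0 -> b0 \notin I0.
  by rewrite /b0; case: pickP => [//|/(_ b) /= ->].
(* If [F] sums weights y and [b0] is outside [I0], both cases give the weight of [i] minus that of
   [a0]. The constant [t] restores the missing weight by matching the value at [I0], which requires
   dividing by k. *)
pose z i := if i \in I0 then F (b0 |: (I0 :\ a0)) - F (b0 |: (I0 :\ i))
            else F (i |: (I0 :\ a0)) - F I0.
pose t := (F I0 - \sum_(i in I0) z i) / k%:R.
exists (fun i => z i + t) => A cA; apply/eqP; rewrite -subr_eq0; apply/eqP.
have kR : k%:R != 0 :> R by rewrite pnatr_eq0 -lt0n.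
have sumI0 : \sum_(i in I0) (z i + t) = F I0.
  by rewrite big_split /= sumr_const cI0 -mulr_natr /t divfK //; ring.
apply: (@flat_vanish (fun B => F B - \sum_(i in B) (z i + t)) I0) cA => //.
- move=> L a b c d cL abcd neqs; have := flatF L a b c d cL abcd neqs.
  case/and4P: abcd => aL bL cNL dL; case/and5P: neqs => ab ac ad bc /andP[bd cd].
  by rewrite !sum_setU_pair //; lra.
- by rewrite sumI0 subrr.
move=> a b aI bI; have b0I := b0P b bI.
rewrite big_setU1 ?inE ?(negPf bI) ?andbF //=.
have := sumI0; rewrite (big_setD1 a) //= => sumI0a.
(* Apart from the trivial cases [a = a0] and [b = b0], this is flatness for the quadruple [a0], [b],
   [b0], [a] over [I0] without [a] and [a0]. *)
suff : F (b |: (I0 :\ a)) + F (b0 |: (I0 :\ a0)) =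
       F (b0 |: (I0 :\ a)) + F (b |: (I0 :\ a0)).
  by move: sumI0a; rewrite /z aI (negPf bI); lra.
have [->|aa0] := eqVneq a a0; first by rewrite addrC.
have [->//|bb0] := eqVneq b b0.
pose L := I0 :\ a :\ a0.
have cL : (#|L| + 2)%N = k.
  rewrite -cI0 (cardsD1 a I0) aI (cardsD1 a0 (I0 :\ a)) !inE eq_sym aa0 a0I.
  by rewrite addnC.
have neq x y : x \in I0 -> y \notin I0 -> x != y.
  by move=> xI yI; apply: contraNneq yI => <-.
have addE x y u : (x, y) = (a, a0) \/ (x, y) = (a0, a) ->
    u |: (I0 :\ x) = L :|: [set y; u].
  move=> xy; have [yI yx LE] : [/\ y \in I0, y != x & L = I0 :\ x :\ y].
    case: xy => -[-> ->]; rewrite ?a0I ?aI ?aa0 1?eq_sym ?aa0; split=> //.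
    by apply/setP => v; rewrite !inE andbCA.
  rewrite LE; apply/setP => v; rewrite !inE.
  case: (eqVneq v u) => //= _; rewrite ?orbT ?orbF //.
  by case: (eqVneq v y) => [->|]; rewrite ?yx ?yI //= orbF.
have := flatF L a0 b b0 a cL.
rewrite !inE !eqxx (negPf bI) (negPf b0I) !andbF /=.
rewrite [b == a]eq_sym [b0 == a]eq_sym [a0 == a]eq_sym aa0 bb0.
rewrite (neq a0 b) // (neq a0 b0) // (neq a b) // (neq a b0) //.
move=> /(_ isT isT).
rewrite (addE a a0 b) ?(addE a0 a b0) ?(addE a a0 b0) ?(addE a0 a b); try by [left|right].
by rewrite [[set b0; a]]finset.setUC [[set b; a]]finset.setUC.
Qed.

End FlatSetFunctions.

(** * Tight terms of sums and multiples, and the points where all terms are tight *)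

Section Tight.
Variables (R : realType) (k n : nat).
Implicit Types (q : relation k n) (x y w : 'rV[R]_(npl k n)).

Lemma mdotDl N (m m' : 'X_{1..N}) (v : 'rV[R]_N) :
  mdot (m + m')%MM v = mdot m v + mdot m' v.
Proof.
by rewrite /mdot -big_split; apply: eq_bigr => i _; rewrite mnmDE natrD mulrDl.
Qed.

Lemma mdotDr N (m : 'X_{1..N}) (u v : 'rV[R]_N) :
  mdot m (u + v) = mdot m u + mdot m v.
Proof. by rewrite /mdot -big_split; apply: eq_bigr => i _; rewrite mxE mulrDr. Qed.

Lemma mdotZr N (m : 'X_{1..N}) (c : R) (v : 'rV[R]_N) :
  mdot m (c *: v) = c * mdot m v.
Proof. by rewrite /mdot mulr_sumr; apply: eq_bigr => i _; rewrite mxE mulrCA. Qed.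

Lemma mdotU N (j : 'I_N) (v : 'rV[R]_N) : mdot U_(j)%MM v = v 0 j.
Proof.
rewrite /mdot (bigD1 j) //= mnm1E eqxx mul1r big1 ?addr0 // => i ij.
by rewrite mnm1E eq_sym (negPf ij) mul0r.
Qed.

(** A term tight at [w] attains the minimum at both [x] and [y], so the minimum at the sum is the
    sum of the minima, and a term reaches it only by reaching both. *)
Lemma tightD w x y : tight w \subset tight x -> tight w \subset tight y ->
  tight (x + y) = tight x :&: tight y.
Proof.
move=> /fintype.subsetP wx /fintype.subsetP wy; apply/setP => -[q i].
rewrite !inE /=; apply/forallP/andP => [xyi|[/forallP xi /forallP yi] j].
  have [j wj] := tight_ex w q.
  have /tightP xj := wx _ wj; have /tightP yj := wy _ wj.
  have := xyi j; rewrite !mdotDr => le; have xji := xj i; have yji := yj i.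
  split; apply/forallP => l; have := xj l; have := yj l; lra.
by rewrite !mdotDr lerD.
Qed.

Lemma tightZ (c : R) x : 0 < c -> tight (c *: x) = tight x.
Proof.
move=> c0; apply/setP => -[q i]; rewrite !inE; apply: eq_forallb => j.
by rewrite !mdotZr ler_pM2l.
Qed.

Lemma tight_setTP x : (tight x = finset.setT) <->
  (forall q i j, mdot (term_mnm q i) x = mdot (term_mnm q j) x).
Proof.
split=> [tx q i j|tx]; first by apply: tight_eq; rewrite tx finset.in_setT.
by apply/setP => -[q i]; rewrite [RHS]inE; apply/tightP => j; rewrite (tx q i j).
Qed.

Lemma tight_add_flat x y : tight y = finset.setT -> tight (x + y) = tight x.
Proof.
by move=> ty; rewrite (@tightD x) ?ty ?finset.subsetT ?finset.setIT.
Qed.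

(* The three sums are permuted by relabelling, so it is enough to know their
   equality for increasing quadruples. *)
Lemma pairing_sums_sorted (P : pred 'I_n) (p : 'I_n -> 'I_n -> R) :
  (forall i j, p i j = p j i) ->
  (forall a b c d, P a -> P b -> P c -> P d -> (a < b)%N -> (b < c)%N -> (c < d)%N ->
     p a b + p c d = p a c + p b d /\ p a b + p c d = p a d + p b c) ->
  forall a b c d, P a -> P b -> P c -> P d ->
    [&& a != b, a != c, a != d, b != c, b != d & c != d] ->
    p a b + p c d = p a c + p b d.
Proof.
move=> psym sorted4.
pose S a b c d := p a b + p c d = p a c + p b d /\ p a b + p c d = p a d + p b c.
have relab a b c d a' b' c' d' : S a' b' c' d' ->
   (a', b', c', d') = (d, a, b, c) \/ (a', b', c', d') = (a, d, b, c) \/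
   (a', b', c', d') = (a, b, d, c) \/ (a', b', c', d') = (a, c, b, d) \/
   (a', b', c', d') = (c, a, b, d) \/ (a', b', c', d') = (b, a, c, d) -> S a b c d.
  rewrite /S => -[h1 h2] h.
  have := (psym a b, psym a c, psym a d, psym b c, psym b d, psym c d).
  move=> [[[[[? ?] ?] ?] ?] ?].
  by case: h => [|[|[|[|[|]]]]] [? ? ? ?]; subst; split; lra.
have neqP (x y : 'I_n) : x != y -> (x < y)%N \/ (y < x)%N.
  by rewrite neq_ltn => /orP.
have sort3 a b c d : P a -> P b -> P c -> P d -> (a < b)%N -> (b < c)%N ->
    [&& a != d, b != d & c != d] -> S a b c d.
  move=> Pa Pb Pc Pd ab bc /and3P[/neqP ad /neqP bd /neqP cd].
  case: ad => [ad|da]; last by apply: (relab _ _ _ _ d a b c); [exact: sorted4|tauto].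
  case: bd => [bd|db]; last by apply: (relab _ _ _ _ a d b c); [exact: sorted4|tauto].
  case: cd => [cd|dc]; last by apply: (relab _ _ _ _ a b d c); [exact: sorted4|tauto].
  exact: sorted4.
have sort2 a b c d : P a -> P b -> P c -> P d -> (a < b)%N ->
    [&& a != c, a != d, b != c, b != d & c != d] -> S a b c d.
  move=> Pa Pb Pc Pd ab /and5P[/neqP ac ad /neqP bc bd cd].
  case: ac => [ac|ca]; last first.
    by apply: (relab _ _ _ _ c a b d); [apply: sort3; rewrite ?ad ?bd ?cd|tauto].
  case: bc => [bc|cb]; last first.
    by apply: (relab _ _ _ _ a c b d); [apply: sort3; rewrite ?ad ?bd ?cd|tauto].
  by apply: sort3; rewrite ?ad ?bd ?cd.
move=> a b c d Pa Pb Pc Pd /and5P[/neqP ab ac ad bc /andP[bd cd]].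
suff [] : S a b c d by [].
case: ab => [ab|ba]; first by apply: sort2; rewrite ?ac ?ad ?bc ?bd ?cd.
by apply: (relab _ _ _ _ b a c d); [apply: sort2; rewrite ?ac ?ad ?bc ?bd ?cd|tauto].
Qed.

Lemma mdot_set_mnm_lin_map (y : 'rV[R]_n) (A : {set 'I_n}) : #|A| = k ->
  mdot (set_mnm k A) (lin_map k y) = \sum_(i in A) y 0 i.
Proof.
by move=> /ksub_of_set[J ->]; rewrite set_mnmE mdotU mxE enum_rankK.
Qed.

(** Each of the three terms covers [L] twice and each of the four other indices once. *)
Lemma tight_lin_map (y : 'rV[R]_n) : tight (lin_map k y) = finset.setT.
Proof.
apply/tight_setTP => q i j.
suff S l : mdot (term_mnm q l) (lin_map k y) =
  let: (L, (a, b, c, d)) := val q in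
  \sum_(i in L) y 0 i *+ 2 + y 0 a + y 0 b + y 0 c + y 0 d by rewrite !S.
rewrite /term_mnm mdotDl; have [c1 c2] := card_term_sets q l.
rewrite !mdot_set_mnm_lin_map //.
case: q c1 c2 => -[L [[[a b] c] d]] /= /is_relationP[cL _ _].
case/and4P=> aL bL cNL dL /and5P[ab ac ad bc /andP[bd cd]] _ _.
by case: l => [[|[|l]] ?] /=; rewrite !sum_setU_pair // sumrMnl; ring.
Qed.

(** The coordinates of [x] form a flat set function, and its weights are a preimage under
    [lin_map]. *)
Lemma tight_setT_lineality x : (0 < k)%N ->
  tight x = finset.setT -> exists z, x = lin_map k z.
Proof.
move=> k0 /tight_setTP flatx.
have [|y yP] := @flat_set_function_additive R k n (fun A => mdot (set_mnm k A) x) k0.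
  move=> L a b c d cL /and4P[aL bL cNL dL] neqs.
  apply: (@pairing_sums_sorted (fun i => i \notin L)
    (fun i j => mdot (set_mnm k (L :|: [set i; j])) x)) => //.
    by move=> i j; rewrite [[set i; j]]finset.setUC.
  move=> {aL bL cNL dL neqs} {}a {}b {}c {}d aL bL cNL dL ab bc cd.
  have rel : is_relation k (L, (a, b, c, d)).
    rewrite /is_relation cL eqxx ab bc cd /= disjoint_sym finset.disjoints_subset.
    by rewrite !finset.subUset !finset.sub1set !inE aL bL cNL dL.
  have eqs := flatx (exist (@is_relation k n) _ rel).
  have := eqs (@Ordinal 3 0 isT) (@Ordinal 3 1 isT).
  have := eqs (@Ordinal 3 0 isT) (@Ordinal 3 2 isT).
  by rewrite /term_mnm !mdotDl /=.
exists (\row_i y i); apply/rowP => j; rewrite !mxE.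
have := yP (val (enum_val j)) (eqP (valP (enum_val j))).
by rewrite set_mnmE enum_valK mdotU => ->; apply: eq_bigr => i _; rewrite mxE.
Qed.

End Tight.

(** * Faces and rational points *)

Section Faces.
Variables (R : realType) (k n : nat).
Implicit Types (q : relation k n) (x y w : 'rV[R]_(npl k n)).

(** The linear span of the cell of [x]: the equalities between terms tight at [x] are kept and the
    inequalities dropped. *)
Definition face_span x y : Prop := forall q i j,
  (q, i) \in tight x -> (q, j) \in tight x ->
  mdot (term_mnm q i) y = mdot (term_mnm q j) y.

Lemma face_span_tight x y : tight x \subset tight y -> face_span x y.
Proof. by move=> /fintype.subsetP xy q i j /xy + /xy; exact: tight_eq. Qed.

Lemma mdotBZ N (m : 'X_{1..N}) (c : R) (u v : 'rV[R]_N) :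
  mdot m (u - c *: v) = mdot m u - c * mdot m v.
Proof. by rewrite mdotDr -scaleNr mdotZr mulNr. Qed.

Lemma tight_neq_setT x : tight x != finset.setT -> exists p, p \notin tight x.
Proof.
move=> xflat; apply: contrapT => /forallNP allx; case/eqP: xflat.
apply/setP => p; rewrite finset.in_setT.
by apply: contrapT => /negP/allx.
Qed.

(** Take the largest [s] for which [y - s *: x] stays in the cell of [x]: the least ratio of the
    slacks of [y] and [x] over the terms not tight at [x]. A term attaining this ratio becomes
    tight. *)
Lemma face_span_push x y : tight x != finset.setT -> face_span x y ->
  exists s, tight x \proper tight (y - s *: x).
Proof.
move=> xflat xy; have [r rP] := choice (tight_ex x).
have [p0 p0x] := tight_neq_setT xflat.
pose slack v (p : relation k n * 'I_3) : R :=
  mdot (term_mnm p.1 p.2) v - mdot (term_mnm p.1 (r p.1)) v.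
have slack0 p : p \notin tight x -> 0 < slack x p.
  case: p => q i nqi; rewrite /slack subr_gt0 lt_neqAle /= andbC.
  have /tightP -> /= := rP q; apply: contra nqi => /eqP e.
  exact: tight_of_eq (rP q) (esym e).
have [p1 p1x p1min] := arg_minP (P := fun p => p \notin tight x)
  (fun p => slack y p / slack x p) p0x.
exists (slack y p1 / slack x p1); set s := _ / _.
have slackE p : slack (y - s *: x) p = slack y p - s * slack x p.
  by rewrite /slack !mdotBZ; ring.
have slack_ge0 p : 0 <= slack (y - s *: x) p.
  rewrite slackE; have [px|px] := boolP (p \in tight x).
    rewrite /slack (tight_eq (i := p.2) (j := r p.1) _ (rP _)) -?surjective_pairing //.
    by rewrite (xy _ p.2 (r p.1)) ?subrr ?mulr0 ?subrr -?surjective_pairing.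
  by rewrite subr_ge0 -ler_pdivlMr ?slack0 //; exact: p1min.
have rtight q : (q, r q) \in tight (y - s *: x).
  by apply/tightP => j; have := slack_ge0 (q, j); rewrite subr_ge0.
have tight_slack p : slack (y - s *: x) p = 0 -> p \in tight (y - s *: x).
  by case: p => q i /subr0_eq e; exact: tight_of_eq (rtight q) e.
apply/properP; split.
  apply/fintype.subsetP => p px; apply: tight_slack; rewrite slackE.
  rewrite /slack (tight_eq (i := p.2) (j := r p.1) _ (rP _)) -?surjective_pairing //.
  by rewrite (xy _ p.2 (r p.1)) ?subrr ?mulr0 ?subrr -?surjective_pairing.
exists p1 => //; apply: tight_slack; rewrite slackE /s divfK ?subrr //.
by rewrite gt_eqF ?slack0.
Qed.

(** Pushing both [y] and [- y] to the boundary of the cell gives two points whose sum is a multiple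
    of [x]. Nonnegative slacks make the factor nonnegative. *)
Lemma face_decomposition x y : tight x != finset.setT -> face_span x y ->
  (forall c, tight (y - c *: x) != finset.setT) ->
  exists y1 y2 c, [/\ 0 < c, c *: x = y1 + y2,
    tight x \proper tight y1 & tight x \proper tight y2].
Proof.
move=> xflat xy yflat.
have [s s1] := face_span_push xflat xy.
have [|s' s2] := @face_span_push x (- y) xflat.
  by move=> q i j qi qj; rewrite -scaleN1r !mdotZr (xy q i j).
pose y1 := y - s *: x; pose y2 := - y - s' *: x.
have sumE : - (s + s') *: x = y1 + y2.
  by rewrite /y1 /y2 scaleNr scalerDl addrACA subrr add0r opprD.
exists y1, y2, (- (s + s')); split=> //.
move: (- (s + s')) sumE => c sumE.
have /fintype.subsetP x1 := proper_sub s1; have /fintype.subsetP x2 := proper_sub s2.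
have slack_sum q i j : (q, i) \in tight x ->
   [/\ 0 <= mdot (term_mnm q j) y1 - mdot (term_mnm q i) y1,
       0 <= mdot (term_mnm q j) y2 - mdot (term_mnm q i) y2 &
   (mdot (term_mnm q j) y1 - mdot (term_mnm q i) y1) +
   (mdot (term_mnm q j) y2 - mdot (term_mnm q i) y2) =
   c * (mdot (term_mnm q j) x - mdot (term_mnm q i) x)].
  move=> qi; have /tightP h1 := x1 _ qi; have /tightP h2 := x2 _ qi.
  have e l : c * mdot (term_mnm q l) x = mdot (term_mnm q l) y1 + mdot (term_mnm q l) y2.
    by rewrite -mdotZr sumE mdotDr.
  split; rewrite ?subr_ge0 ?h1 ?h2 //.
  by rewrite mulrBr !e; ring.
have [[q j] qjx] := tight_neq_setT xflat.
have [i qi] := tight_ex x q.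
have slackx : 0 < mdot (term_mnm q j) x - mdot (term_mnm q i) x.
  rewrite subr_gt0 lt_neqAle andbC; have /tightP -> /= := qi.
  by apply: contra qjx => /eqP e; apply: tight_of_eq qi (esym e).
have c0 : 0 <= c.
  have [h1 h2 h3] := slack_sum q i j qi.
  by rewrite -(pmulr_lge0 _ slackx) -h3 addr_ge0.
(* If the factor were 0, the nonnegative slacks of [y1] and [y2] would cancel, so all terms would be
   tight at [y1], against the hypothesis on [y]. *)
rewrite lt_neqAle c0 andbT eq_sym; apply/eqP => cE.
case/eqP: (yflat s); rewrite -/y1; apply/tight_setTP => q' i' j'.
have [l ql] := tight_ex x q'.
suff eqs t : mdot (term_mnm q' t) y1 = mdot (term_mnm q' l) y1 by rewrite !eqs.
have [h1 h2] := slack_sum q' l t ql; rewrite cE mul0r => h3; lra.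
Qed.

Lemma rational_multiple N (v : 'rV[rat]_N) :
  exists (d : int) (z : 'rV[int]_N), d != 0 /\
    map_mx intr z = d%:~R *: map_mx ratr v :> 'rV[R]_N.
Proof.
exists (\prod_l denq (v 0 l)).
exists (\row_l (numq (v 0 l) * \prod_(l' | l' != l) denq (v 0 l'))).
split; first by apply/prodf_neq0 => l _; exact: denq_neq0.
apply/rowP => l; rewrite !mxE [in RHS](bigD1 l) //= !intrM.
suff -> : (numq (v 0 l))%:~R = (denq (v 0 l))%:~R * ratr (v 0 l) :> R by ring.
have /(congr1 (@ratr R)) := divq_num_den (v 0 l).
rewrite fmorph_div /= !ratr_int => <-.
by rewrite mulrC divfK // intr_eq0 denq_neq0.
Qed.

(* face_span x is the kernel of an integer matrix, so it is spanned by rational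
   vectors, and one of them lies outside the lineality space. *)
Lemma face_span_int x : tight x != finset.setT ->
  exists z : 'rV[int]_(npl k n), face_span x (map_mx intr z) /\
    tight (map_mx intr z : 'rV[R]_(npl k n)) != finset.setT.
Proof.
move=> xflat; pose T : finType := (relation k n * 'I_3 * 'I_3)%type.
pose A : 'M[rat]_(npl k n, #|T|) := \matrix_(l, t)
  let: (q, i, j) := enum_val t in
  if ((q, i) \in tight x) && ((q, j) \in tight x)
  then (term_mnm q i l)%:R - (term_mnm q j l)%:R else 0.
pose AR : 'M[R]_(npl k n, #|T|) := map_mx ratr A.
have ARE (v : 'rV[R]_(npl k n)) t : (v *m AR) 0 t = let: (q, i, j) := enum_val t in
    if ((q, i) \in tight x) && ((q, j) \in tight x)
    then mdot (term_mnm q i) v - mdot (term_mnm q j) v else 0.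
  rewrite mxE; case e : (enum_val t) => [[q i] j].
  case: ifP => c; last first.
    by rewrite big1 // => l _; rewrite !mxE e c rmorph0 mulr0.
  rewrite /mdot -sumrB; apply: eq_bigr => l _; rewrite !mxE e c rmorphB /=.
  by rewrite !ratr_nat; ring.
have spanP (v : 'rV[R]_(npl k n)) : v *m AR = 0 <-> face_span x v.
  split=> [v0 q i j qi qj|xv].
    have := ARE v (enum_rank (q, i, j)); rewrite v0 enum_rankK qi qj mxE /=.
    by move=> /esym/subr0_eq.
  apply/rowP => t; rewrite ARE mxE; case: (enum_val t) => [[q i] j].
  by case: ifP => // /andP[qi qj]; rewrite (xv q i j) ?subrr.
have /submxP[D xD] : (x <= map_mx ratr (kermx A))%MS.
  rewrite map_kermx; apply/sub_kermxP/spanP; exact: face_span_tight.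
(* Otherwise all terms would be tight at every row of the rational kernel, hence at their
   combination [x]. *)
have [r rflat] : exists r, tight (row r (map_mx ratr (kermx A)) : 'rV[R]_(npl k n))
    != finset.setT.
  apply: contrapT => /forallNP allflat; case/eqP: xflat.
  apply/tight_setTP => q i j; rewrite xD mulmx_sum_row.
  have sumE m : mdot m (\sum_r D 0 r *: row r (map_mx ratr (kermx A))) =
      \sum_r D 0 r * mdot m (row r (map_mx ratr (kermx A)) : 'rV[R]_(npl k n)).
    elim/big_ind2: _ => [|u a v b <- <-|l _].
    - by rewrite -(scale0r 0) mdotZr mul0r.
    - by rewrite mdotDr.
    - by rewrite mdotZr.
  rewrite !sumE; apply: eq_bigr => r _; congr (_ * _).
  by have /negP := allflat r; rewrite negbK => /eqP/tight_setTP.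
have rowE : row r (map_mx ratr (kermx A)) = map_mx ratr (row r (kermx A)) :> 'rV[R]_(npl k n).
  by rewrite map_row.
have [d [z [d0 zE]]] := rational_multiple (row r (kermx A)).
exists z; rewrite zE -rowE.
have dR : d%:~R != 0 :> R by rewrite intr_eq0.
split.
  by apply/spanP; rewrite -scalemxAl -row_mul map_kermx mulmx_ker row0 scaler0.
apply: contra rflat => /eqP/tight_setTP flatd; apply/eqP/tight_setTP => q i j.
by apply: (mulfI dR); rewrite -!mdotZr.
Qed.

End Faces.

(** * Rays and compatible collections modulo lineality *)

Section Quotient.
Variables (R : realType) (k n : nat).
Hypothesis k_gt0 : (0 < k)%N.
Local Notation Q := (qspace R k n).
Implicit Types (x y w : 'rV[R]_(npl k n)) (u v : Q).

Lemma qprojZ (c : R) x : qproj (c *: x) = c *: qproj x.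
Proof. by rewrite -qscale_proj. Qed.

Lemma qproj_eq0 x : (qproj x = 0) <-> (tight x = finset.setT).
Proof.
have <- : qproj 0 = 0 :> Q by have := qprojZ 0 0; rewrite !scale0r.
rewrite qprojP subr0; split=> [[z ->]|]; first exact: tight_lin_map.
exact: tight_setT_lineality.
Qed.

Definition qtight u := tight (repr u).

(** Two representatives differ by a lineality vector, at which all terms are tight. *)
Lemma qtight_proj x : qtight (qproj x) = tight x.
Proof.
have /qprojP[z xz] := qproj_repr (qproj x).
by rewrite /qtight -[repr _](subrK x) xz addrC tight_add_flat // tight_lin_map.
Qed.

Lemma qtight_eq0 u : (qtight u = finset.setT) <-> (u = 0).
Proof. by rewrite -qproj_eq0 qproj_repr. Qed.

Lemma qtightD w u v : tight w \subset qtight u -> tight w \subset qtight v ->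
  qtight (u + v) = qtight u :&: qtight v.
Proof.
move=> wu wv; rewrite -{1}[u]qproj_repr -{1}[v]qproj_repr -qprojD qtight_proj.
exact: tightD wu wv.
Qed.

Lemma qtightZ_gt0 (c : R) u : 0 < c -> qtight (c *: u) = qtight u.
Proof. by move=> c0; rewrite -{1}[u]qproj_repr -qprojZ qtight_proj tightZ. Qed.

Lemma qtightZ w (c : R) u : 0 <= c -> tight w \subset qtight u ->
  tight w \subset qtight (c *: u).
Proof.
rewrite le_eqVlt => /orP[/eqP <- _|c0]; last by rewrite qtightZ_gt0.
by rewrite scale0r (qtight_eq0 0).2 // finset.subsetT.
Qed.

Lemma qcellP w u : ((@qproj R k n @` cell w)%classic u) <-> tight w \subset qtight u.
Proof.
split=> [[x /cellP wx <-]|wu]; first by rewrite qtight_proj.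
by exists (repr u); [apply/cellP|exact: qproj_repr].
Qed.

(** Differences of term values are linear forms that do not depend on the representative. Together
    they separate points of the quotient, and they are integral on the lattice. *)
Definition qform (p : relation k n * 'I_3 * 'I_3) u : R :=
  mdot (term_mnm p.1.1 p.1.2) (repr u) - mdot (term_mnm p.1.1 p.2) (repr u).

Lemma qform_proj p x : qform p (qproj x) =
  mdot (term_mnm p.1.1 p.1.2) x - mdot (term_mnm p.1.1 p.2) x.
Proof.
have /qprojP[z xz] := qproj_repr (qproj x).
have /tight_setTP eqs := tight_lin_map k z.
rewrite /qform -[repr _](subrK x) xz !mdotDr (eqs _ p.1.2 p.2).
by rewrite opprD addrACA subrr add0r.
Qed.

Lemma qformZ p (c : R) u : qform p (c *: u) = c * qform p u.
Proof.
by rewrite -[u]qproj_repr -qprojZ !qform_proj !mdotZr mulrBr.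
Qed.

Lemma qform_neq0 u : u != 0 -> exists p, qform p u != 0.
Proof.
move=> u0; apply: contrapT => /forallNP allz; case/eqP: u0.
apply/qtight_eq0/tight_setTP => q i j; apply: subr0_eq.
by apply/eqP; have /negP := allz (q, i, j); rewrite negbK.
Qed.

Lemma qform_int p u : lattice u -> exists a : int, qform p u = a%:~R.
Proof.
move=> [z _ <-]; rewrite qform_proj.
have intE m : exists a : int, mdot m (map_mx intr z) = a%:~R :> R.
  exists (\sum_l (m l)%:Z * z 0 l); rewrite /mdot rmorph_sum /=.
  by apply: eq_bigr => l _; rewrite mxE intrM.
have [a ->] := intE (term_mnm p.1.1 p.1.2); have [b ->] := intE (term_mnm p.1.1 p.2).
by exists (a - b); rewrite intrB.
Qed.

Lemma latticeD u v (a b : int) : lattice u -> lattice v ->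
  lattice (a%:~R *: u + b%:~R *: v).
Proof.
move=> [y _ <-] [z _ <-]; exists (a *: y + b *: z) => //.
rewrite -!qprojZ -qprojD; congr qproj.
by apply/rowP => l; rewrite !mxE intrD !intrM.
Qed.

(** An integral form nonzero at [u] shows that [s] is a fraction B/A in lowest terms. Bezout
    coefficients give a lattice vector [e *: u] with [A%:R * e = 1]; then [u] and [v] are A and B
    times this vector, and primitivity forces A = B = 1. *)
Lemma primitive_proportional u v (s : R) :
  primitive u -> primitive v -> 0 < s -> v = s *: u -> v = u.
Proof.
move=> [Lu u0 primu] [Lv v0 primv] s0 vsu.
have [p pu] := qform_neq0 u0.
have [a ea] := qform_int p Lu; have [b eb] := qform_int p Lv.
have bsa : b%:~R = s * a%:~R :> R by rewrite -eb -ea vsu qformZ.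
have a0 : (0 < `|a|)%N by rewrite absz_gt0 -(@intr_eq0 R) -ea.
have absE : `|b|%N%:R = s * `|a|%N%:R :> R.
  by rewrite !natr_absz !intr_norm bsa normrM gtr0_norm.
have b0 : (0 < `|b|)%N by rewrite -(@ltr0n R) absE mulr_gt0 ?ltr0n.
pose g := gcdn `|a| `|b|; pose A := (`|a| %/ g)%N; pose B := (`|b| %/ g)%N.
have g0 : (0 < g)%N by rewrite gcdn_gt0 a0.
have aA : `|a|%N = (A * g)%N by rewrite divnK // dvdn_gcdl.
have bB : `|b|%N = (B * g)%N by rewrite divnK // dvdn_gcdr.
have ABs : B%:R = s * A%:R :> R.
  have gR : g%:R != 0 :> R by rewrite pnatr_eq0 -lt0n.
  by apply: (mulIf gR); rewrite -mulrA -!natrM -aA -bB.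
have cop : coprime A B.
  by rewrite /coprime -(eqn_pmul2r g0) mul1n muln_gcdl -aA -bB.
have A0 : (0 < A)%N by case: (A) aA a0 => [->|].
have [[c d] /= cd] := coprimeP _ A0 cop.
have {}cd : c%:R * A%:R - d%:R * B%:R = 1 :> R.
  by rewrite -!natrM -natrB ?cd // ltnW // -subn_gt0 cd.
pose e : R := c%:R - d%:R * s.
have Ae : A%:R * e = 1.
  by apply: etrans cd; rewrite /e ABs; ring.
have Le : lattice (e *: u).
  have -> : e *: u = c%:Z%:~R *: u + (- d%:Z)%:~R *: v.
    by rewrite vsu scalerA -scalerDl intrN mulNr.
  exact: latticeD.
have A1 : A = 1%N by apply: (primu A (e *: u)); rewrite ?scalerA ?Ae ?scale1r.
have B1 : B = 1%N.
  by apply: (primv B (e *: u)); rewrite ?scalerA ?ABs -?mulrA ?Ae ?mulr1.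
by move: ABs; rewrite A1 B1 mulr1 vsu => <-; rewrite scale1r.
Qed.

(** An integral form nonzero at [u] bounds every integer dividing [u] in the lattice; the largest
    such integer leaves a primitive quotient. *)
Lemma primitive_divisor u : lattice u -> u != 0 ->
  exists2 v, primitive v & exists2 m : nat, (0 < m)%N & u = m%:R *: v.
Proof.
move=> Lu u0; pose P m := `[< exists2 v, lattice v & u = m%:R *: v >].
have [p pu] := qform_neq0 u0; have [a ea] := qform_int p Lu.
have exP : exists m, P m by exists 1%N; apply/asboolP; exists u; rewrite ?scale1r.
have ubP m : P m -> (m <= `|a|)%N.
  move=> /asboolP[v Lv uv]; have [b eb] := qform_int p Lv.
  have ab : a = m%:Z * b by apply: (@intr_inj R); rewrite -ea uv qformZ eb intrM.
  rewrite ab abszM absz_nat leq_pmulr // absz_gt0; apply: contraNneq pu => b0.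
  by rewrite ea ab b0 mulr0.
case: (ex_maxnP exP ubP) => m /asboolP[v Lv uv] mmax.
have m0 : (0 < m)%N.
  by rewrite lt0n; apply: contraNneq u0 => m0; rewrite uv m0 scale0r.
exists v; last by exists m.
split=> //; first by apply: contraNneq u0 => v0; rewrite uv v0 scaler0.
move=> r v' Lv' vv'; have : P (m * r)%N.
  by apply/asboolP; exists v' => //; rewrite natrM -scalerA -vv'.
move=> /mmax; rewrite -{2}[m]muln1 leq_pmul2l //.
case: r vv' => [|[]] //; rewrite scale0r => v0.
by case/eqP: u0; rewrite uv v0 scaler0.
Qed.

(** * Ray generators and the generation of cells *)

Variable chi : ksub k n -> R.
Hypothesis chi_real : realizable_uniform_chirotope chi.

Lemma dressian_tight x y : dressian chi x -> tight x \subset tight y ->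
  dressian chi y.
Proof.
move=> /(dressianP chi_real) Dx /fintype.subsetP xy.
apply/(dressianP chi_real) => q; have [i [j [si sj qi qj]]] := Dx q.
by exists i, j; split=> //; exact: xy.
Qed.

Lemma qdressianP u : qdressian chi u <-> dressian chi (repr u).
Proof.
split=> [[x Dx <-]|Du]; last by exists (repr u); [|exact: qproj_repr].
by apply: dressian_tight Dx _; rewrite -/(qtight _) qtight_proj.
Qed.

(** A ray is the cell of its own generator: the point [w] defining the cell lies on the ray, and it
    is a positive multiple of [u] since otherwise all terms would be tight at [u]. *)
Lemma ray_generatorsP u : ray_generators chi u <->
  [/\ primitive u, dressian chi (repr u) &
   forall v, qtight u \subset qtight v -> exists2 t : R, 0 <= t & v = t *: u].
Proof.
split=> [[pu [w Dw rayE]]|[pu Du ray]]; last first.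
  split=> //; exists (repr u) => //; apply/seteqP; split=> v /=.
    by move=> [t t0 <-]; apply/qcellP/qtightZ.
  by move=> /qcellP /ray[t t0 ->]; exists t.
have [_ u0 _] := pu.
have wray : ((@qproj R k n @` cell w)%classic (qproj w)).
  by apply/qcellP; rewrite qtight_proj.
have uray : ((@qproj R k n @` cell w)%classic u).
  by rewrite -rayE; exists 1; rewrite /= ?ler01 ?scale1r.
move: wray; rewrite -rayE => -[t /= t0 tE].
have {}t0 : 0 < t.
  rewrite lt_neqAle t0 andbT eq_sym; apply: contraNneq u0 => t0'.
  apply/eqP/qtight_eq0/eqP; rewrite finset.eqEsubset finset.subsetT /=.
  have <- : tight w = finset.setT by apply/qproj_eq0; rewrite -tE t0' scale0r.
  by apply/qcellP.
have wu : tight w = qtight u by rewrite -qtight_proj -tE qtightZ_gt0.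
split=> //; first by apply: dressian_tight Dw _; rewrite wu.
move=> v; rewrite -wu => /qcellP; rewrite -rayE => -[t' /= ? <-].
by exists t'.
Qed.

Lemma ray_generators_inj u v : ray_generators chi u -> ray_generators chi v ->
  qtight u = qtight v -> v = u.
Proof.
move=> /ray_generatorsP[pu _ ray] /ray_generatorsP[pv _ _] uv.
have [|t t0 vt] := ray v; first by rewrite uv.
apply: (primitive_proportional pu pv _ vt); rewrite lt_neqAle t0 andbT eq_sym.
by have [_ v0 _] := pv; apply: contraNneq v0 => t0'; rewrite vt t0' scale0r.
Qed.

(** A ray generator is determined by its set of tight terms, and there are finitely many such
    sets. *)
Lemma rays_fset w : exists G : {fset Q}, forall u,
  u \in G <-> ray_generators chi u /\ tight w \subset qtight u.
Proof.
have /choice[f fP] : forall T : {set relation k n * 'I_3}, exists u,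
    forall v, ray_generators chi v -> qtight v = T -> v = u.
  move=> T; have [[u [ru uT]]|nou] := pselect (exists u,
    ray_generators chi u /\ qtight u = T).
    by exists u => v rv vT; apply: ray_generators_inj => //; rewrite uT.
  by exists 0 => v rv vT; case: nou; exists v.
exists [fset u in [seq f T | T <- enum {: {set relation k n * 'I_3}}] |
   `[< ray_generators chi u /\ tight w \subset qtight u >]]%fset => u.
rewrite !inE /=; split=> [/andP[_ /asboolP]//|h].
apply/andP; split; last exact/asboolP.
by apply/mapP; exists (qtight u); rewrite ?mem_enum //; apply: fP; case: h.
Qed.

Definition convex_cone (C : set Q) : Prop :=
  [/\ C 0, forall u v, C u -> C v -> C (u + v) &
   forall (c : R) u, 0 <= c -> C u -> C (c *: u)].

Lemma convex_cone_qcell w : convex_cone (@qproj R k n @` cell w)%classic.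
Proof.
split=> [|u v /qcellP wu /qcellP wv|c u c0 /qcellP wu]; apply/qcellP.
- by rewrite (qtight_eq0 0).2 // finset.subsetT.
- by rewrite (qtightD wu wv) finset.subsetI wu.
- exact: qtightZ.
Qed.

Lemma convex_cone_of (S : {fset Q}) : convex_cone (cone_of S).
Proof.
split=> [|_ _ [s s0 ->] [t t0 ->]|c _ c0 [t t0 ->]].
- by exists (fun=> 0) => //; rewrite big1 // => u _; rewrite scale0r.
- exists (fun u => s u + t u) => [u|]; first by rewrite addr_ge0.
  by rewrite -big_split; apply: eq_bigr => u _; rewrite scalerDl.
- exists (fun u => c * t u) => [u|]; first by rewrite mulr_ge0.
  by rewrite scaler_sumr; apply: eq_bigr => u _; rewrite scalerA.
Qed.

Lemma sub_cone_of (S : {fset Q}) u : u \in S -> cone_of S u.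
Proof.
move=> uS; exists (fun v => (v == u)%:R) => [v|]; first by rewrite ler0n.
rewrite (bigD1_seq u) ?fset_uniq //= eqxx scale1r big1 ?addr0 // => v vu.
by rewrite (negPf vu) scale0r.
Qed.

Lemma cone_of_sub (S : {fset Q}) (C : set Q) : convex_cone C ->
  (forall u, u \in S -> C u) -> (cone_of S `<=` C)%classic.
Proof.
move=> [C0 CD CZ] SC _ [t t0 ->]; rewrite big_seq.
by elim/big_ind: _ => // u uS; apply: CZ => //; exact: SC.
Qed.

(* If x spans an extreme ray modulo lineality, that ray has a primitive
   generator; otherwise x is a positive combination of two points with more
   tight terms. *)
Lemma cell_generated x (C : set Q) : convex_cone C -> dressian chi x ->
  (forall u, ray_generators chi u -> tight x \subset qtight u -> C u) ->
  C (qproj x).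
Proof.
move=> [C0 CD CZ]; have [m] := ubnP #|~: tight x|.
elim: m x => // m IHm x; rewrite ltnS => xm Dx Crays.
have [xflat|xflat] := eqVneq (tight x) finset.setT.
  by rewrite (qproj_eq0 x).2.
have [[y [xy yflat]]|noy] := pselect (exists y, face_span x y /\
    forall c, tight (y - c *: x) != finset.setT).
  have [y1 [y2 [c [c0 xE x1 x2]]]] := face_decomposition xflat xy yflat.
  have step y' : tight x \proper tight y' -> C (qproj y').
    move=> xy'; have sub := proper_sub xy'; apply: IHm.
    - apply: leq_trans xm; apply: proper_card.
      by rewrite finset.properC.
    - exact: dressian_tight Dx sub.
    - by move=> u ru y'u; apply: Crays => //; exact: fintype.subset_trans y'u.
  have -> : qproj x = c^-1 *: (qproj y1 + qproj y2).
    by rewrite -qprojD -xE -qprojZ scalerA mulVf ?scale1r // gt_eqF.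
  by apply: CZ; [rewrite invr_ge0 ltW|apply: CD; exact: step].
(* In the remaining case the span of the cell is the line through [x] modulo lineality. *)
have spanx y : face_span x y -> exists c, qproj y = c *: qproj x.
  move=> xy; apply: contrapT => noc; apply: noy; exists y; split=> // c.
  apply/eqP => /qproj_eq0; rewrite qprojD -scaleNr qprojZ scaleNr => /subr0_eq e.
  by apply: noc; exists c.
have [z [xz zflat]] := face_span_int xflat; have [c zc] := spanx _ xz.
have x0 : qproj x != 0 by apply: contra_neq xflat => /qproj_eq0.
have z0 : qproj (map_mx intr z) != 0 :> Q by apply: contra_neq zflat => /qproj_eq0.
have c0 : c != 0 by apply: contraNneq z0 => c0; rewrite zc c0 scale0r.
(* The factor [c] may be negative; its absolute value keeps the lattice vector on the ray of [x] and
   not on the opposite one. *)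
have Lz : lattice (`|c| *: qproj x).
  have Lz : lattice (qproj (map_mx intr z) : Q) by exists z.
  case: (ger0P c) => _; rewrite ?scaleNr -zc //.
  have := latticeD (-1) 0 Lz Lz.
  by rewrite scale0r addr0 intrN scaleN1r.
have xc0 : `|c| *: qproj x != 0 by rewrite scaler_eq0 negb_or normr_eq0 c0.
have [v pv [r r0 xrv]] := primitive_divisor Lz xc0.
have r0R : 0 < r%:R :> R by rewrite ltr0n.
have xv : qproj x = (`|c|^-1 * r%:R) *: v.
  by rewrite -scalerA -xrv scalerA mulVf ?scale1r // normr_eq0.
have t0 : 0 < `|c|^-1 * r%:R by rewrite mulr_gt0 // invr_gt0 normr_gt0.
have tv : qtight v = tight x by rewrite -(qtight_proj x) xv qtightZ_gt0.
rewrite xv; apply: CZ; [exact: ltW|apply: Crays; last by rewrite tv].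
apply/ray_generatorsP; split=> //.
  by apply: dressian_tight Dx _; rewrite -/(qtight v) tv.
move=> v' vv'; rewrite tv in vv'; have [c' vc'] := spanx _ (face_span_tight vv').
rewrite qproj_repr in vc'; exists (c' * (`|c|^-1 * r%:R)); last first.
  by rewrite vc' xv scalerA.
apply: mulr_ge0; last exact: ltW.
(* For negative [c'], the cell would contain [v'] and its opposite. Their sum 0 has all terms tight,
   which forces all terms to be tight at [x]. *)
rewrite leNgt; apply/negP => c'0; case/eqP: xflat.
have xx : qtight (- c' *: qproj x) = tight x.
  by rewrite qtightZ_gt0 ?oppr_gt0 // qtight_proj.
have := qtightD vv' (_ : tight x \subset qtight (- c' *: qproj x)).
rewrite {1}vc' scaleNr subrr (qtight_eq0 0).2 // -scaleNr xx => /(_ (fintype.subxx _)) e.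
by apply/eqP; rewrite finset.eqEsubset finset.subsetT e finset.subsetIr.
Qed.

(** Each point of the cell is generated by the rays of its own cell, and these lie in the cell of
    [w]. *)
Lemma cone_of_rays w (G : {fset Q}) : dressian chi w ->
  (forall u, u \in G <-> ray_generators chi u /\ tight w \subset qtight u) ->
  cone_of G = (@qproj R k n @` cell w)%classic.
Proof.
move=> Dw GP; apply/seteqP; split.
  apply: cone_of_sub; first exact: convex_cone_qcell.
  by move=> u /GP[_ wu]; apply/qcellP.
move=> u /qcellP wu; rewrite -[u]qproj_repr; apply: cell_generated.
- exact: convex_cone_of.
- exact: dressian_tight Dw wu.
- move=> v rv uv; apply: sub_cone_of; apply/GP; split=> //.
  exact: fintype.subset_trans wu uv.
Qed.

(** * Compatible collections and maximal cones *)

Lemma compatible_in_cell w (S : {fset Q}) : dressian chi w ->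
  (forall u, u \in S -> ray_generators chi u /\ tight w \subset qtight u) ->
  compatible_collection chi S.
Proof.
move=> Dw SP; split=> [u /SP[]//|u v /SP[_ wu] /SP[_ wv]].
apply/qdressianP/(dressian_tight Dw).
by rewrite -/(qtight _) (qtightD wu wv) finset.subsetI wu.
Qed.

(** Slacks measured against a common tight term are nonnegative, so their sum vanishes exactly when
    each of them does. *)
Lemma tight_sum (S : {fset Q}) :
  (forall q, exists i, forall u, u \in S -> (q, i) \in qtight u) ->
  forall q j, (q, j) \in tight (\sum_(u <- S) repr u) <->
    forall u, u \in S -> (q, j) \in qtight u.
Proof.
move=> common q j; have [i iP] := common q.
have mdot_sum m : mdot m (\sum_(u <- S) repr u) = \sum_(u <- S) mdot m (repr u).
  elim/big_ind2: _ => [|x a y b <- <-|//]; last by rewrite mdotDr.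
  by rewrite -(scale0r 0) mdotZr mul0r.
split=> [/tightP/(_ i)|jP]; last first.
  apply/tightP => l; rewrite !mdot_sum !big_seq; apply: ler_sum => u uS.
  by have /tightP := jP _ uS; apply.
rewrite -subr_le0 !mdot_sum -sumrB => le0.
have ge0 u : u \in S -> 0 <= mdot (term_mnm q j) (repr u) - mdot (term_mnm q i) (repr u).
  by move=> uS; have /tightP := iP _ uS; rewrite subr_ge0; apply.
have /eqP : \sum_(u <- S) (mdot (term_mnm q j) (repr u) - mdot (term_mnm q i) (repr u)) = 0.
  by apply/le_anti; rewrite le0 big_seq sumr_ge0.
rewrite big_seq psumr_eq0 // => /allP zero u uS.
by apply: tight_of_eq (iP _ uS) _; have := zero u uS; rewrite uS => /eqP/subr0_eq.
Qed.

(** Two signs are spread over three terms and both occur, so one sign occurs exactly once; [a] is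
    the term carrying it. *)
Lemma term_sign_single q : exists a b c, [/\ forall i : 'I_3, i = a \/ i = b \/ i = c,
  term_sign chi q b = - term_sign chi q a & term_sign chi q c = - term_sign chi q a].
Proof.
pose o (m : nat) (h : (m < 3)%N) : 'I_3 := Ordinal h.
have ordP (i : 'I_3) : i = o 0%N isT \/ i = o 1%N isT \/ i = o 2%N isT.
  by case: i => [[|[|[|]]] ?] //; [left|right; left|right; right]; apply/val_inj.
have [i [j [si sj]]] := term_sign_mixed chi_real q.
have s i := term_sign_cases chi_real q i.
have same t : ~ (term_sign chi q (o 0%N isT) = t /\ term_sign chi q (o 1%N isT) = t /\
    term_sign chi q (o 2%N isT) = t).
  move=> [s0 [s1 s2]]; have st l : term_sign chi q l = t.
    by case: (ordP l) => [->|[->|->]].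
  by move: si sj; rewrite !st => ->; lra.
have perm : forall a b c : 'I_3, (forall i, i = a \/ i = b \/ i = c) ->
    (forall i, i = b \/ i = a \/ i = c) /\ (forall i, i = c \/ i = a \/ i = b).
  by move=> a b c h; split=> l; have := h l; tauto.
have [ordP1 ordP2] := perm _ _ _ ordP.
case: (s (o 0%N isT)) => s0; case: (s (o 1%N isT)) => s1; case: (s (o 2%N isT)) => s2.
- by case: (same 1).
- by exists (o 2%N isT), (o 0%N isT), (o 1%N isT); rewrite s0 s1 s2 opprK.
- by exists (o 1%N isT), (o 0%N isT), (o 2%N isT); rewrite s0 s1 s2 opprK.
- by exists (o 0%N isT), (o 1%N isT), (o 2%N isT); rewrite s0 s1 s2.
- by exists (o 0%N isT), (o 1%N isT), (o 2%N isT); rewrite s0 s1 s2 opprK.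
- by exists (o 1%N isT), (o 0%N isT), (o 2%N isT); rewrite s0 s1 s2.
- by exists (o 2%N isT), (o 0%N isT), (o 1%N isT); rewrite s0 s1 s2.
- by case: (same (-1)).
Qed.

(* Every point of the Dressian has the single term [a] of a relation tight,
   together with [b] or [c]; pairwise compatible points share one of these two,
   hence so does the whole collection. *)
Lemma compatible_cell (S : {fset Q}) : compatible_collection chi S ->
  exists2 w, dressian chi w & forall u, u \in S -> tight w \subset qtight u.
Proof.
move=> [rays compat].
have SD u : u \in S -> dressian chi (repr u).
  by move=> uS; have /ray_generatorsP[] := rays _ uS.
have common q : exists i j, [/\ term_sign chi q i = 1, term_sign chi q j = -1,
    forall u, u \in S -> (q, i) \in qtight u &
    forall u, u \in S -> (q, j) \in qtight u].
  have [a [b [c [abc sb sc]]]] := term_sign_single q.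
  have tightab x : dressian chi x -> (q, a) \in tight x /\
      ((q, b) \in tight x \/ (q, c) \in tight x).
    move=> /(dressianP chi_real)/(_ q)[i [j [si sj qi qj]]].
    case: (abc i) (abc j) si sj qi qj => [->|[->|->]] [->|[->|->]];
      rewrite ?sb ?sc; try (by tauto); lra.
  have aP u : u \in S -> (q, a) \in qtight u.
    by move=> /SD/tightab[].
  have bcP u v : u \in S -> v \in S ->
     (q, b) \in qtight u /\ (q, b) \in qtight v \/
     (q, c) \in qtight u /\ (q, c) \in qtight v.
    move=> uS vS; have /qdressianP/tightab[_] := compat u v uS vS.
    have /tightP au := aP u uS; have /tightP av := aP v vS.
    have both i : (q, i) \in tight (repr u + repr v) ->
       (q, i) \in qtight u /\ (q, i) \in qtight v.
      move=> /tightP/(_ a); rewrite !mdotDr => le; have := au i; have := av i.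
      by split; [apply: tight_of_eq (aP u uS) _|apply: tight_of_eq (aP v vS) _]; lra.
    have -> : tight (repr (u + v)) = tight (repr u + repr v).
      by rewrite -/(qtight _) -[u in LHS]qproj_repr -[v in LHS]qproj_repr -qprojD qtight_proj.
    by move=> [/both|/both] ?; [left|right].
  have [d sd dP] : exists2 d, term_sign chi q d = - term_sign chi q a &
      forall u, u \in S -> (q, d) \in qtight u.
    (* If [b] fails to be tight at some [u], then every [v] has to share [c] with this [u]. *)
    have [allb|] := pselect (forall u, u \in S -> (q, b) \in qtight u).
      by exists b.
    move=> /existsNP[u /not_implyP[uS /negP nb]]; exists c => // v vS.
    by have [[ub _]|[]//] := bcP u v uS vS; rewrite ub in nb.
  have [sa|sa] := term_sign_cases chi_real q a.
    by exists a, d; rewrite sd sa.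
  by exists d, a; rewrite sd sa opprK.
(* The common tight term of positive sign serves as the reference in each relation. *)
have tightS := @tight_sum S (fun q => let: ex_intro i (ex_intro _ (And4 _ _ iP _)) := common q in
  ex_intro _ i iP).
exists (\sum_(u <- S) repr u).
  apply/(dressianP chi_real) => q; have [i [j [si sj iP jP]]] := common q.
  by exists i, j; split=> //; apply/tightS.
by move=> u uS; apply/fintype.subsetP => -[q j] /tightS; apply.
Qed.

Lemma maximal_compatible_absorbs (S : {fset Q}) w : maximal_compatible chi S ->
  dressian chi w -> (forall u, u \in S -> tight w \subset qtight u) ->
  forall u, ray_generators chi u -> tight w \subset qtight u -> u \in S.
Proof.
move=> [[rays _] maxS] Dw wS u ru wu.
rewrite -(maxS (u |` S)%fset) ?fset1U1 ?fsubsetU1 //.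
apply: compatible_in_cell Dw _ => v /fset1UP[->//|vS]; split; last exact: wS.
exact: rays.
Qed.

Lemma cone_of_maximal_compatible (S : {fset Q}) w : maximal_compatible chi S ->
  dressian chi w -> (forall u, u \in S -> tight w \subset qtight u) ->
  cone_of S = (@qproj R k n @` cell w)%classic.
Proof.
move=> maxS Dw wS; apply: cone_of_rays => // u; split=> [uS|[ru wu]].
  by have [[rays _] _] := maxS; split; [exact: rays|exact: wS].
exact: maximal_compatible_absorbs maxS Dw wS u ru wu.
Qed.

(** A fan cone containing the cone of [S] is a cell containing all of [S]. By maximality of [S] its
    ray generators are exactly [S], so it equals the cone of [S]. *)
Lemma maximal_compatible_cone (S : {fset Q}) :
  maximal_compatible chi S -> maximal_cone chi (cone_of S).
Proof.
move=> maxS; have [w Dw wS] := compatible_cell maxS.1.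
split=> [|_ [w' Dw' ->] sub].
  by exists w => //; exact: cone_of_maximal_compatible.
by rewrite (cone_of_maximal_compatible maxS Dw') // => u /sub_cone_of/sub/qcellP.
Qed.

(** The collection is the set [G] of all ray generators in [C]. Any other candidate consists of ray
    generators lying in [C], hence is contained in [G] and equals it by its own maximality. *)
Lemma maximal_cone_collection (C : set Q) : maximal_cone chi C ->
  exists! S : {fset Q}, maximal_compatible chi S /\ C = cone_of S.
Proof.
move=> [[w Dw CE] maxC]; have [G GP] := rays_fset w.
have GE := cone_of_rays Dw GP.
have compG : compatible_collection chi G by apply: compatible_in_cell Dw _ => u /GP.
exists G; split; last first.
  move=> S [maxS CS]; apply: maxS.2 => //; apply/fsubsetP => u uS; apply/GP.
  split; first by have [[rays _] _] := maxS; exact: rays.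
  by apply/qcellP; rewrite -CE CS; exact: sub_cone_of.
split; last by rewrite CE GE.
split=> // T compT GT; apply/eqP; rewrite eqEfsubset GT andbT.
(* A compatible [T] containing [G] lies in a single cell. That cell contains [C], hence equals it,
   which puts [T] inside [G]. *)
have [w' Dw' wT] := compatible_cell compT.
have DC : (@qproj R k n @` cell w')%classic = C.
  apply: maxC; first by exists w'.
  rewrite CE -GE; apply: cone_of_sub; first exact: convex_cone_qcell.
  by move=> u /(fsubsetP GT) uT; apply/qcellP/wT.
apply/fsubsetP => u uT; apply/GP; split; first exact: compT.1.
by apply/qcellP; rewrite -CE -DC; apply/qcellP/wT.
Qed.

End Quotient.

Theorem theorem3p6 (R : realType) (k n : nat) (hk : (0 < k)%N)
    (hkn : (k <= n)%N) (chi : ksub k n -> R)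
    (hchi : realizable_uniform_chirotope chi) :
  (forall S : {fset qspace R k n},
     maximal_compatible chi S -> maximal_cone chi (cone_of S)) /\
  (forall C : set (qspace R k n), maximal_cone chi C ->
     exists! S : {fset qspace R k n},
       maximal_compatible chi S /\ C = cone_of S).
Proof.
split=> [S|C]; first exact: maximal_compatible_cone.
exact: maximal_cone_collection.
Qed.
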